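(* Let $A$ be the twisted symmetric algebra of a finite group $G$ over the subalgebra $\bar{A}$, with $K$ as in the context. If the group $G$ is cyclic, then there exists a bijection $$\mathrm{Irr}(K\bar{A})/G\ \longleftrightarrow\ \mathrm{Irr}(KA)/G^\vee,\qquad \bar{\Omega}\leftrightarrow\Omega$$ such that $$\bar{e}(\bar{\Omega})=e(\Omega),\qquad |\bar{\Omega}|\,|\Omega|=|G|,$$ $$\mathrm{Res}_{K\bar{A}}^{KA}(\chi)=\sum_{\bar{\chi}\in\bar{\Omega}}\bar{\chi}\ \text{ for all }\chi\in\Omega,\qquad \mathrm{Ind}_{K\bar{A}}^{KA}(\bar{\chi})=\sum_{\chi\in\Omega}\chi\ \text{ for all }\bar{\chi}\in\bar{\Omega}.$$ Moreover, for all $\chi\in\Omega$ and $\bar{\chi}\in\bar{\Omega}$, we have $s_\chi=|\Omega|\,s_{\bar{\chi}}$.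
   Context: Setting. $\mathcal{O}$ is a Noetherian integrally closed domain with field of fractions $F$; $A$ is an $\mathcal{O}$-algebra, free and finitely generated as an $\mathcal{O}$-module, with a symmetrizing form $t$ (an $\mathcal{O}$-linear map $t:A\to\mathcal{O}$ with $t(ab)=t(ba)$ such that $a\mapsto(x\mapsto t(ax))$ is an isomorphism $A\to\mathrm{Hom}_{\mathcal{O}}(A,\mathcal{O})$). A subalgebra $\bar A$ is a symmetric subalgebra if $\bar A$ is free of finite rank over $\mathcal{O}$, the restriction $\bar t$ of $t$ to $\bar A$ is a symmetrizing form on $\bar A$, and $A$ is free of finite rank as a left $\bar A$-module. $A$ is the twisted symmetric algebra of the finite group $G$ over $\bar A$ if $\bar A$ is a symmetric subalgebra of $A$ and there are $\mathcal{O}$-submodules $(A_g)_{g\in G}$ of $A$ with $A=\bigoplus_{g\in G}A_g$, $A_gA_h=A_{gh}$ for all $g,h\in G$, $A_1=\bar A$, and $t(A_g)=0$ for $g\neq 1$. For each $g$ there is a unit $a_g$ of $A$ lying in $A_g$ with $A_g=a_g\bar A=\bar A a_g$; these are fixed, with $a_1=1$. $K$ is a finite Galois extension of $F$ such that $KA:=K\otimes_{\mathcal{O}}A$ and $K\bar A$ are split semisimple, and all group algebras over $K$ considered are split semisimple. $\mathrm{Irr}$ denotes the set of irreducible characters. For $\chi\in\mathrm{Irr}(KA)$ and $\bar\chi\in\mathrm{Irr}(K\bar A)$, $e(\chi)$ and $\bar e(\bar\chi)$ are the corresponding central primitive idempotents of $KA$ and $K\bar A$; for sets $\Omega,\bar\Omega$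 of characters, $e(\Omega)=\sum_{\chi\in\Omega}e(\chi)$ and $\bar e(\bar\Omega)=\sum_{\bar\chi\in\bar\Omega}\bar e(\bar\chi)$. $G$ acts on $Z(K\bar A)$ by $g(z)=a_gza_g^{-1}$ and on $\mathrm{Irr}(K\bar A)$ by $\bar e(g(\bar\chi))=g(\bar e(\bar\chi))$. For $G$ abelian, $G^\vee:=\mathrm{Irr}(KG)=\mathrm{Hom}(G,K^\times)$ acts on $\mathrm{Irr}(KA)$ by $\chi\mapsto\chi\cdot\xi$, where $(\chi\cdot\xi)(\bar aa_g)=\chi(\bar aa_g)\xi(g)$ for $\bar a\in K\bar A$, $g\in G$. $X/G$ denotes the set of orbits. Schur elements: for $\chi\in\mathrm{Irr}(KA)$, $s_\chi:=\omega_\chi(\chi^\vee)$, where $\chi^\vee\in Z(KA)$ is defined by $t(\chi^\vee a)=\chi(a)$ for all $a\in KA$ and $\omega_\chi:Z(KA)\to K$ is the central character of $\chi$; $s_{\bar\chi}$ is defined likewise with respect to $\bar t$. *)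

(* Defs.v *)
From HB Require Import structures.
From mathcomp Require Import all_boot all_order all_algebra all_fingroup.
From mathcomp Require Import all_solvable all_field all_character.
From mathcomp Require Import finmap all_classical.

Set Implicit Arguments.
Unset Strict Implicit.
Unset Printing Implicit Defensive.

Import GRing.Theory.
Local Open Scope ring_scope.

(* Submodules, ideals and subalgebras are boolean predicates; in the presence of
   excluded middle these are all the subsets. *)

Definition noetherian (O : comNzRingType) : Prop :=
  forall I : {pred O^o}, GRing.submod_closed I ->
  exists n (s : 'I_n -> O),
    forall x : O, x \in I <-> exists c : 'I_n -> O, x = \sum_i c i * s i.

Definition integrally_closed (O : idomainType) : Prop :=
  forall u : {fraction O}, integralOver (@FracField.tofrac O) u ->
  exists x : O, u = FracField.tofrac x.

Definition scal (O : idomainType) (K : splittingFieldType {fraction O}) :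
  {rmorphism O -> K} := in_alg K \o @FracField.tofrac O.

Section SymmetricAlgebras.
Variables (O : idomainType) (A : unitAlgType O).
Implicit Types (S Abar : {pred A}) (t : A -> O).

Definition free_finite S : Prop :=
  exists n (b : 'I_n -> A), (forall i, b i \in S) /\
    {in S, forall x, exists! c : {ffun 'I_n -> O}, x = \sum_i c i *: b i}.

(* [S] is [A] itself (as [predT]) or a subalgebra. Elements of Hom_O(S, O) are
   represented by functions on [A] of which only the values on [S] matter. *)
Definition symmetrizing_form S t : Prop :=
  {in S &, forall a b, t (a * b) = t (b * a)} /\
  forall phi : A -> O,
    (forall c, {in S &, forall x y, phi (c *: x + y) = c * phi x + phi y}) ->
    exists! a, a \in S /\ {in S, forall x, t (a * x) = phi x}.

Definition left_free_finite Abar : Prop :=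
  exists n (b : 'I_n -> A), forall x : A,
    exists! c : {ffun 'I_n -> A},
      (forall i, c i \in Abar) /\ x = \sum_i c i * b i.

Record symmetric_subalgebra t Abar : Prop := SymmetricSubalgebra {
  symsub_subalg : GRing.subalg_closed Abar;
  symsub_free : free_finite Abar;
  symsub_form : symmetrizing_form Abar t;
  symsub_left_free : left_free_finite Abar }.

Variable gT : finGroupType.
Implicit Types (Ag : gT -> {pred A}) (a : gT -> A).

Record twisted_symmetric t Abar Ag : Prop := TwistedSymmetric {
  twist_sub : symmetric_subalgebra t Abar;
  twist_submod : forall g, GRing.submod_closed (Ag g);
  twist_direct : forall x : A, exists! y : {ffun gT -> A},
    (forall g, y g \in Ag g) /\ x = \sum_g y g;
  twist_mul : forall g h x, x \in Ag (g * h)%g <->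
    exists n (u v : 'I_n -> A),
      (forall i, u i \in Ag g /\ v i \in Ag h) /\ x = \sum_i u i * v i;
  twist_one : Ag 1%g =i Abar;
  twist_form : forall g, g != 1%g -> {in Ag g, forall x, t x = 0} }.

Definition twisted_units Abar Ag a : Prop :=
  a 1%g = 1 /\
  forall g, [/\ a g \is a GRing.unit, a g \in Ag g,
    forall x, x \in Ag g <-> exists2 b, b \in Abar & x = a g * b &
    forall x, x \in Ag g <-> exists2 b, b \in Abar & x = b * a g].

End SymmetricAlgebras.

Section ScalarExtension.
Variables (O : nzRingType) (K : fieldType) (f : {rmorphism O -> K}).
Variables (A : unitAlgType O) (KA : falgType K).
Variable iota : {lrmorphism A -> KA | f \; *:%R}.

(* [KA], with [iota a] in the role of 1 (x) a, is the tensor product of K and A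
   over O: it has its universal property. *)
Definition is_scalar_extension : Prop :=
  forall (V : lmodType K) (g : {linear A -> V | f \; *:%R}),
  exists h : {linear KA -> V},
    (forall a, h (iota a) = g a) /\
    forall h' : {linear KA -> V}, (forall a, h' (iota a) = g a) -> h' =1 h.

Definition in_scalar_span (S : {pred A}) (x : KA) : Prop :=
  exists n (c : 'I_n -> K) (b : 'I_n -> A),
    (forall i, b i \in S) /\ x = \sum_i c i *: iota (b i).

End ScalarExtension.

Section Characters.
Variables (K : fieldType) (E : falgType K).
Implicit Types (chi : E -> K) (e z : E).

(* A matrix representation makes the column vectors a left [E]-module. *)
Definition irreducible_repr n (rho : {lrmorphism E -> 'M[K]_n}) : Prop :=
  (0 < n)%N /\
  forall U : {vspace 'cV[K]_n},
    (forall a v, v \in U -> rho a *m v \in U) -> U = 0%VS \/ U = fullv.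

Definition affords n (rho : {lrmorphism E -> 'M[K]_n}) chi : Prop :=
  forall a, chi a = \tr (rho a).

Definition Irr : set (E -> K) :=
  [set chi | exists n (rho : {lrmorphism E -> 'M[K]_n}),
     irreducible_repr rho /\ affords rho chi].

Definition left_ideal (U : {vspace E}) : Prop := (fullv * U <= U)%VS.

Definition semisimple : Prop :=
  forall U : {vspace E}, left_ideal U ->
  exists W : {vspace E},
    [/\ left_ideal W, (U + W)%VS = fullv & (U :&: W)%VS = 0%VS].

Definition split_algebra : Prop :=
  forall n (rho : {lrmorphism E -> 'M[K]_n}), irreducible_repr rho ->
  forall M : 'M[K]_n, (forall a, M *m rho a = rho a *m M) -> is_scalar_mx M.

Definition split_semisimple : Prop := semisimple /\ split_algebra.

Definition central z : Prop := forall a, z * a = a * z.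

Definition central_idempotent e : Prop := central e /\ e * e = e.

Definition central_primitive_idempotent e : Prop :=
  [/\ central_idempotent e, e != 0 &
      forall f, central_idempotent f -> f * e = f -> f = 0 \/ f = e].

(* In the definitions below [xget] picks the unique element of the given set;
   its first argument is the junk value for an empty set. *)

(* e(chi): the central primitive idempotent acting as the identity on the simple
   module with character [chi]. *)
Definition idem chi : E :=
  xget 0 [set e | central_primitive_idempotent e /\
    exists n (rho : {lrmorphism E -> 'M[K]_n}),
      [/\ irreducible_repr rho, affords rho chi & rho e = 1%:M]].

Definition idem_sum (Omega : set (E -> K)) : E :=
  \sum_(chi \in Omega) idem chi.

Definition central_character chi z : K :=
  xget 0 [set c | exists n (rho : {lrmorphism E -> 'M[K]_n}),
    [/\ irreducible_repr rho, affords rho chi & rho z = c%:M]].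

Definition dual_element (t : E -> K) chi : E :=
  xget 0 [set z | central z /\ forall a, t (z * a) = chi a].

Definition schur_element (t : E -> K) chi : K :=
  central_character chi (dual_element t chi).

End Characters.

Arguments Irr {K} E.

Section RestrictionInduction.
Variables (K : fieldType) (E : falgType K) (B : {aspace E}).

Definition Res (chi : E -> K) : subvs_of B -> K := fun b => chi (vsval b).

(* [sigma], with the [B]-linear map [u : K^n -> K^m] in the role of
   v |-> 1 (x) v, is the tensor product of [E] with the left module of [rho]
   over [B]: it has its universal property (among finite-dimensional modules,
   which is enough as this tensor product is finite-dimensional). *)
Definition is_induced n (rho : {lrmorphism subvs_of B -> 'M[K]_n})
    m (sigma : {lrmorphism E -> 'M[K]_m}) : Prop :=
  exists u : 'M[K]_(m, n),
    (forall b, sigma (vsval b) *m u = u *m rho b) /\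
    forall k (tau : {lrmorphism E -> 'M[K]_k}) (f : 'M[K]_(k, n)),
      (forall b, tau (vsval b) *m f = f *m rho b) ->
      exists! h : 'M[K]_(k, m),
        (forall a, tau a *m h = h *m sigma a) /\ h *m u = f.

Definition Ind (psi : subvs_of B -> K) : E -> K :=
  xget (fun=> 0) [set chi |
    exists n (rho : {lrmorphism subvs_of B -> 'M[K]_n})
           m (sigma : {lrmorphism E -> 'M[K]_m}),
      [/\ affords rho psi, is_induced rho sigma & affords sigma chi]].

Variables (gT : finGroupType) (a : gT -> E).

(* g(psi): the irreducible character whose idempotent is
   a_g * e(psi) * a_g^-1. *)
Definition conj_char (g : gT) (psi : subvs_of B -> K) : subvs_of B -> K :=
  xget psi [set psi' | Irr (subvs_of B) psi' /\
    vsval (idem psi') = a g * vsval (idem psi) * (a g)^-1].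

Definition twist_char (xi : gT -> K) (chi : E -> K) : E -> K :=
  xget chi [set chi' | scalar chi' /\
    forall (b : subvs_of B) g,
      chi' (vsval b * a g) = chi (vsval b * a g) * xi g].

End RestrictionInduction.

(* Hom(G, K^x): the values are automatically nonzero. *)
Definition dual_group (gT : finGroupType) (K : fieldType) : set (gT -> K) :=
  [set xi | xi 1%g = 1 /\ forall g h, xi (g * h)%g = xi g * xi h].
Arguments dual_group : clear implicits.

(* The group algebra through its modules: its regular module is semisimple and
   its simple modules are absolutely simple. *)
Definition group_algebra_split_semisimple (gT : finGroupType) (K : fieldType) :
    Prop :=
  inhabited (mx_completely_reducible (regular_repr K [set: gT]) 1%:M) /\
  group_splitting_field K [set: gT].

Definition orbits (X T : Type) (act : X -> T -> T) (G : set X) (S : set T) :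
    set (set T) :=
  [set [set act g x | g in G]%classic | x in S]%classic.

(* 0 for infinite sets. *)
Definition ncard (T : choiceType) (S : set T) : nat := #|` fset_set S|%fset.

(* Main.v *)
Require Import Defs.
From HB Require Import structures.
From mathcomp Require Import all_boot all_order all_algebra all_fingroup.
From mathcomp Require Import all_solvable all_field all_character.
From mathcomp Require Import finmap all_classical.

Set Implicit Arguments.
Unset Strict Implicit.
Unset Printing Implicit Defensive.

Import GRing.Theory.
Local Open Scope ring_scope.

(** Write E for KA and B for KAbar. Everything happens over the field K, where
    E is the direct sum of the subspaces B a_g, each unit a_g normalises B, and
    the symmetrizing form vanishes on B a_g for g != 1. These facts are
    collected in [crossed_product], and [extension_crossed_product] derives
    them from the integral data: dual bases of A and of Abar over O show that
    the form stays non-degenerate on E and on B, and then its vanishing on the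
    B a_g forces their sum to be direct.

    Two groups act. G conjugates B through the units a_g, and a linear
    character xi of G gives the automorphism [theta] of E that multiplies B a_g
    by xi g. Since G is abelian and K splits its group algebra, the linear
    characters separate the elements of G ([abelian_dual_separates]), so the
    elements of E fixed by every [theta] are those of B.

    Call psi in Irr B and chi in Irr E linked when e(chi) e(psi) != 0. Summing
    e(psi') over a G-orbit gives an element that commutes with B and with the
    a_g, so it is central in E; summing e(chi') over an orbit of the dual group
    gives an element fixed by every [theta], so it is central in B. As e(chi)
    and e(psi) are primitive central idempotents, multiplying them by these two
    sums shows that the characters linked to a given chi form one G-orbit
    ([link_orbG]), that those linked to a given psi form one orbit of the dual
    group ([link_orbD]), and that the two sums are equal ([orbit_idem_eq]).
    This is the bijection.

    That G is cyclic is what makes restriction multiplicity free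
    ([link_restriction]). Let e = e(psi) and let h generate the stabiliser of
    psi. Conjugation by a_h is an automorphism of the matrix algebra B e, hence
    inner, so a_h e = u y with u in B and y commuting with B. All powers of a_h
    e lie in B y^k e, so y commutes with e E e and acts as a scalar on e V,
    where V affords chi. The action of e E e on e V is therefore that of B e:
    the B-module e V is simple and affords psi.

    Knowing this, the dimension of E e(chi) e(psi) is deg chi times deg psi
    ([link_dim]). Comparing the decompositions of E e(chi) and of E e(psi) into
    such pieces with dim E e(psi) = #|G| dim B e(psi) gives |Obar| |Om| = #|G|
    ([orbit_count]). The induced character is given by an explicit formula
    ([IndE]); both it and the sum over Om vanish on B a_g for g != 1, and on B
    they are the same multiple of the sum over Obar ([orbit_induction]).
    Finally the form is a multiple of chi on the block of chi, the multiplier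
    being the inverse of the Schur element ([schur_elementE]); it is constant
    on Om, and restricting the form to the block of psi adds up |Om| equal
    multipliers ([orbit_schur]).

    The characteristic of K may be positive, so degrees and multiplicities are
    counted as dimensions and never read off from values of characters. *)

(** * Linear functions and matrices *)

Section LinearFunctions.
Variables (K : fieldType) (V W : lmodType K) (f : V -> W) (f_lin : linear f).

(** The linearity proof is an argument so that the structure instance can be
    declared from it. *)
Definition linear_fun_def (_ : linear f) := f.
HB.instance Definition _ :=
  GRing.isLinear.Build K V W *:%R (linear_fun_def f_lin) f_lin.
Definition mk_linear : {linear V -> W} := linear_fun_def f_lin.

Lemma linear_funZ k x : f (k *: x) = k *: f x.
Proof. by rewrite -[f]/(mk_linear : V -> W) linearZ. Qed.
Lemma linear_fun_sum I r (P : pred I) (F : I -> V) :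
  f (\sum_(i <- r | P i) F i) = \sum_(i <- r | P i) f (F i).
Proof. by rewrite -[f]/(mk_linear : V -> W) linear_sum. Qed.
End LinearFunctions.

Section Scalar.
Variables (K : fieldType) (V : lmodType K) (f : V -> K) (f_lin : scalar f).
Lemma scalar_funZ k x : f (k *: x) = k * f x.
Proof. exact: (@linear_funZ K V K^o f f_lin). Qed.
Lemma scalar_fun_sum I r (P : pred I) (F : I -> V) :
  f (\sum_(i <- r | P i) F i) = \sum_(i <- r | P i) f (F i).
Proof. exact: (@linear_fun_sum K V K^o f f_lin). Qed.
End Scalar.

Lemma eq_mulmx_cV (R : fieldType) m n (M N : 'M[R]_(m, n)) :
  (forall v : 'cV_n, M *m v = N *m v) -> M = N.
Proof.
move=> eqMN; apply/matrixP=> i j.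
by have /matrixP/(_ i ord0) := eqMN (delta_mx j 0); rewrite -!colE !mxE.
Qed.

Lemma hom_cV_mx (R : fieldType) m n (T : 'Hom('cV[R]_n, 'cV[R]_m)) :
  exists M : 'M_(m, n), forall v, T v = M *m v.
Proof.
exists (\matrix_(i, j) T (delta_mx j 0) i 0) => v.
rewrite {1}[v]matrix_sum_delta linear_sum; apply/matrixP=> i j.
rewrite summxE [RHS]mxE; apply: eq_bigr => k _.
by rewrite (ord1 j) big_ord1 linearZ mxE [X in _ = X * _]mxE mulrC.
Qed.

(** * Density: split irreducible representations are surjective *)

Section Representations.
Variables (K : fieldType) (E : falgType K) (n : nat).

Section Build.
Variables (f : E -> 'M[K]_n) (f_lin : linear f) (f_mon : monoid_morphism f).

(** As for linear functions, the two proofs are arguments for the sake of the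
    structure instances. *)
Definition repr_fun (_ : linear f) (_ : monoid_morphism f) := f.
HB.instance Definition _ :=
  GRing.isLinear.Build K E 'M[K]_n *:%R (repr_fun f_lin f_mon) f_lin.
HB.instance Definition _ :=
  GRing.isMonoidMorphism.Build E 'M[K]_n (repr_fun f_lin f_mon) f_mon.

Definition mk_repr : {lrmorphism E -> 'M[K]_n} := repr_fun f_lin f_mon.
End Build.

Variable rho : {lrmorphism E -> 'M[K]_n}.

Lemma repr1 : rho 1 = 1%:M. Proof. by rewrite rmorph1. Qed.
Lemma reprM x y : rho (x * y) = rho x *m rho y. Proof. by rewrite rmorphM. Qed.

Definition orbit_map (v : 'cV[K]_n) x := rho x *m v.
Fact orbit_map_linear v : linear (orbit_map v).
Proof. by move=> k x y; rewrite /orbit_map linearP mulmxDl scalemxAl. Qed.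
HB.instance Definition _ v :=
  GRing.isLinear.Build K E 'cV[K]_n *:%R (orbit_map v) (orbit_map_linear v).

Definition orbit_hom v : 'Hom(E, 'cV[K]_n) := linfun (orbit_map v).
Lemma orbit_homE v x : orbit_hom v x = rho x *m v. Proof. by rewrite lfunE. Qed.

Definition annihilator (U : {vspace 'cV[K]_n}) : {vspace E} :=
  (\bigcap_(i < \dim U) lker (orbit_hom (vbasis U)`_i))%VS.

Lemma annihilatorP (U : {vspace 'cV[K]_n}) x :
  reflect {in U, forall u, rho x *m u = 0} (x \in annihilator U).
Proof.
apply: (iffP idP) => [xU u uU | xU].
  rewrite (coord_vbasis uU) mulmx_sumr big1 // => i _.
  rewrite -scalemxAr; move: xU; rewrite memvE => /subv_bigcapP/(_ i isT).
  by rewrite -memvE memv_ker orbit_homE => /eqP->; rewrite scaler0.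
rewrite memvE; apply/subv_bigcapP => i _; rewrite -memvE memv_ker orbit_homE.
by rewrite xU // vbasis_mem // mem_nth // size_tuple.
Qed.

Lemma limg_orbit_hom_stable (I : {vspace E}) v : left_ideal I ->
  forall x w, w \in (orbit_hom v @: I)%VS ->
    rho x *m w \in (orbit_hom v @: I)%VS.
Proof.
move=> idI x w /memv_imgP [y yI ->].
rewrite orbit_homE mulmxA -reprM -orbit_homE memv_img //.
by apply: (subvP idI); rewrite memv_mul ?memvf.
Qed.

Lemma left_idealP (I : {vspace E}) :
  left_ideal I <-> forall x y, y \in I -> x * y \in I.
Proof.
split=> [idI x y yI | idI].
  by apply: (subvP idI); rewrite memv_mul ?memvf.
by apply/prodvP => x y _; apply: idI.
Qed.

Hypothesis irr_rho : irreducible_repr rho.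

(** For a left ideal I the set I v is a subrepresentation, so it is everything
    as soon as it is not zero. *)
Lemma irr_gen (I : {vspace E}) (v : 'cV_n) x : left_ideal I -> x \in I ->
  rho x *m v != 0 -> forall w, exists2 y, y \in I & rho y *m v = w.
Proof.
move=> idI xI xv0 w.
have [] := (proj2 irr_rho) _ (@limg_orbit_hom_stable _ v idI) => [V0 | Vf].
  have: orbit_hom v x \in (orbit_hom v @: I)%VS by rewrite memv_img.
  by rewrite V0 memv0 orbit_homE (negPf xv0).
have: w \in (orbit_hom v @: I)%VS by rewrite Vf memvf.
by case/memv_imgP=> y yI ->; exists y; rewrite ?orbit_homE.
Qed.

Lemma irr_cyclic (v w : 'cV_n) : v != 0 -> exists y, rho y *m v = w.
Proof.
move=> v0; case: (@irr_gen fullv v 1 _ _ _ w) => [|||y _ <-].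
- by rewrite /left_ideal subvf.
- by rewrite memvf.
- by rewrite repr1 mul1mx.
by exists y.
Qed.

Hypothesis schur : forall M : 'M[K]_n,
  (forall x, M *m rho x = rho x *m M) -> is_scalar_mx M.

(** Jacobson density, by induction on the dimension of U. Split off a line <w>
    from U and let I be the annihilator of the rest U'; by induction I w is
    everything. If every x in I killing w killed v, then x w |-> x v would be a
    well-defined intertwiner, hence a scalar c, so I would kill v - c w and
    this vector would lie in U' by induction, contradicting that v is outside
    U. *)
Lemma ann_separates (U : {vspace 'cV_n}) v : v \notin U ->
  exists x, {in U, forall u, rho x *m u = 0} /\ rho x *m v != 0.
Proof.
move: {2}(\dim U) (erefl (\dim U)) => d; elim: d => [|d IHd] in U v *.
  move/eqP; rewrite dimv_eq0 => /eqP-> vU; exists 1; split.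
    by move=> u; rewrite memv0 => /eqP->; rewrite mulmx0.
  by rewrite repr1 mul1mx; rewrite memv0 in vU.
move=> dimU vU; pose w := vpick U; pose U' := (U :\: <[w]>)%VS.
have wU : w \in U := memv_pick U.
have w0 : w != 0 by rewrite vpick0 -dimv_eq0 dimU.
have sU : (U' + <[w]> = U)%VS.
  by rewrite addv_diff; apply/addv_idPl; rewrite -memvE.
have dimU' : \dim U' = d.
  have := dimv_disjoint_sum (capv_diff U <[w]>).
  by rewrite -/U' sU dimU dim_vline w0 addn1 => -[].
have wU' : w \notin U'.
  apply/negP=> wU'; case/negP: w0.
  by rewrite -memv0 -(capv_diff U <[w]>) memv_cap wU' memv_line.
have [x0 [x0U' x0w]] := IHd _ _ dimU' wU'.
pose I := annihilator U'.
have idI : left_ideal I.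
  apply/left_idealP=> x y /annihilatorP yU'; apply/annihilatorP=> u uU'.
  by rewrite reprM -mulmxA yU' // mulmx0.
have Iw := irr_gen idI (introT (annihilatorP _ _) x0U') x0w.
apply: contrapT => noX.
(* Such an x kills U' and w, hence U. *)
have Iv x : x \in I -> rho x *m w = 0 -> rho x *m v = 0.
  move=> /annihilatorP xI xw; apply/eqP/negPn/negP => xv; apply: noX; exists x.
  split=> // u; rewrite -sU => /memv_addP[u1 u1U' [_ /vlineP[k ->] ->]].
  by rewrite mulmxDr xI // add0r -scalemxAr xw scaler0.
pose g := (orbit_hom w \o projv I)%VF; pose h := (orbit_hom v \o projv I)%VF.
have gf : limg g = fullv.
  apply/eqP; rewrite eqEsubv subvf; apply/subvP => z _.
  have [y yI <-] := Iw z; apply/memv_imgP; exists y; rewrite ?memvf //.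
  by rewrite comp_lfunE projv_id // orbit_homE.
(* The map x w |-> x v, as a matrix M: lift a vector to I along x |-> x w, then
   apply the lift to v. *)
have [M MT] := hom_cV_mx (h \o g^-1)%VF.
have Mw x : x \in I -> M *m (rho x *m w) = rho x *m v.
  move=> xI; rewrite -MT comp_lfunE.
  have gx : g x = rho x *m w by rewrite comp_lfunE projv_id // orbit_homE.
  have hx : h x = rho x *m v by rewrite comp_lfunE projv_id // orbit_homE.
  rewrite -gx -hx; apply/eqP; rewrite -subr_eq0 -linearB /=.
  rewrite comp_lfunE orbit_homE Iv ?memv_proj // -orbit_homE -comp_lfunE -/g.
  by rewrite linearB /= limg_lfunVK ?subrr // gf memvf.
have [c Mc] : exists c, M = c%:M.
  apply/is_scalar_mxP/schur => x; apply: eq_mulmx_cV => z.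
  have [y yI <-] := Iw z; rewrite -!mulmxA (Mw y) //.
  rewrite [rho x *m (rho y *m w)]mulmxA [rho x *m (rho y *m v)]mulmxA -!reprM.
  by rewrite Mw //; move/left_idealP: idI; apply.
have vcw : v - c *: w \in U'.
  apply/negPn/negP=> /(IHd _ _ dimU') [x [xU']]; case/eqP.
  rewrite mulmxBr -(Mw x); last exact/annihilatorP.
  by rewrite Mc mul_scalar_mx -scalemxAr subrr.
case/negP: vU; rewrite -sU -[v](subrK (c *: w)) memv_add //.
by rewrite memvZ // memv_line.
Qed.

(** Burnside's theorem. To hit the elementary matrix at (i, j), take an element
    killing all basis vectors but the j-th and move the image of that one to
    the i-th basis vector. *)
Lemma irr_surjective (M : 'M[K]_n) : exists x, rho x = M.
Proof.
have unit_im (ij : 'I_n * 'I_n) : exists x, rho x = delta_mx ij.1 ij.2.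
  case: ij => i j /=.
  pose U := lker (linfun (row j : 'cV[K]_n -> 'rV[K]_1)).
  have eU : (delta_mx j 0 : 'cV[K]_n) \notin U.
    rewrite memv_ker lfunE /=; apply/eqP=> /matrixP/(_ 0 0).
    by rewrite !mxE !eqxx => /eqP; rewrite oner_eq0.
  have [x [xU xe]] := ann_separates eU.
  have [y yxe] := irr_cyclic (delta_mx i 0) xe.
  exists (y * x); apply: eq_mulmx_cV => v.
  have vU : v - v j 0 *: delta_mx j 0 \in U.
    rewrite memv_ker lfunE /=; apply/eqP/matrixP=> a b.
    by rewrite !mxE !ord1 !eqxx mulr1 subrr.
  rewrite -[v in LHS](subrK (v j 0 *: delta_mx j 0)) mulmxDr reprM -!mulmxA.
  rewrite xU // mulmx0 add0r -!scalemxAr yxe.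
  apply/matrixP=> a b; rewrite !mxE (bigD1 j) //= big1 => [|k kj].
    by rewrite !mxE !ord1 !eqxx /= andbT addr0 mulrC.
  by rewrite !mxE (negPf kj) andbF mul0r.
have [F FE] := choice unit_im.
exists (\sum_i \sum_j M i j *: F (i, j)).
rewrite linear_sum [RHS]matrix_sum_delta; apply: eq_bigr => i _.
by rewrite linear_sum; apply: eq_bigr => j _; rewrite linearZ /= FE.
Qed.

End Representations.

(** * Subrepresentations and intertwiners *)

Section StableSubspace.
Variables (K : fieldType) (E : falgType K) (V : vectType K).
Variables (act : E -> V -> V) (U : {vspace V}).
Hypothesis act_linl : forall v, linear (act^~ v).
Hypothesis act_linr : forall x, linear (act x).
Hypothesis actM : forall x y v, act (x * y) v = act x (act y v).
Hypothesis act1 : {in U, forall v, act 1 v = v}.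
Hypothesis actU : forall x v, v \in U -> act x v \in U.

Let b := vbasis U.
Let n := \dim U.

Definition sub_fun x : 'M[K]_n := \matrix_(i, j) coord b i (act x b`_j).

Let bU (i : 'I_n) : b`_i \in U.
Proof. by rewrite vbasis_mem // mem_nth // size_tuple. Qed.

Let act_sum x I r (F : I -> V) c :
  act x (\sum_(i <- r) c i *: F i) = \sum_(i <- r) c i *: act x (F i).
Proof.
elim: r => [|i r IHr]; last by rewrite !big_cons act_linr IHr.
by rewrite !big_nil; have /= := act_linr x (-1) 0 0; rewrite !scaleN1r !addNr.
Qed.

Fact sub_fun_linear : linear sub_fun.
Proof.
by move=> k x y; apply/matrixP=> i j; rewrite !mxE act_linl linearP.
Qed.

Fact sub_fun_monoid : monoid_morphism sub_fun.
Proof.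
split=> [|x y]; apply/matrixP=> i j; rewrite !mxE.
  by rewrite act1 // coord_free ?(basis_free (vbasisP U)) // eq_sym.
rewrite actM [act y _](coord_vbasis (actU _ (bU _))) act_sum linear_sum.
by apply: eq_bigr => k _; rewrite linearZ /= !mxE mulrC.
Qed.

(** A stable subspace of any module becomes a matrix representation through a
    basis. The unit need only act as the identity on U, which allows U to be
    the image of an idempotent. *)
Definition sub_repr := mk_repr sub_fun_linear sub_fun_monoid.

Definition sub_val (v : 'cV[K]_n) : V := \sum_i v i 0 *: b`_i.

Fact sub_val_linear : linear sub_val.
Proof.
move=> k v w; rewrite /sub_val scaler_sumr -big_split; apply: eq_bigr => i _ /=.
by rewrite !mxE scalerDl scalerA.
Qed.
HB.instance Definition _ :=
  GRing.isLinear.Build K 'cV[K]_n V *:%R sub_val sub_val_linear.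

Lemma sub_val_inj : injective sub_val.
Proof.
apply: raddf_inj => v v0; apply/matrixP=> i j; rewrite (ord1 j) mxE.
by move: v0 => /freeP; apply; apply: basis_free (vbasisP U).
Qed.

Lemma sub_val_mem v : sub_val v \in U.
Proof. by apply: memv_suml => i _; rewrite memvZ. Qed.

Lemma sub_val_surj u : u \in U -> exists v, sub_val v = u.
Proof.
move=> uU; exists (\col_i coord b i u); rewrite [RHS](coord_vbasis uU).
by apply: eq_bigr => i _; rewrite mxE.
Qed.

Lemma sub_valM x v : sub_val (sub_repr x *m v) = act x (sub_val v).
Proof.
rewrite /sub_val act_sum.
under [RHS]eq_bigr do
  rewrite [act x _](coord_vbasis (actU _ (bU _))) scaler_sumr.
rewrite exchange_big; apply: eq_bigr => i _ /=; rewrite mxE scaler_suml.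
by apply: eq_bigr => j _; rewrite !mxE scalerA mulrC.
Qed.

Lemma sub_repr_irr : U != 0%VS ->
  (forall W : {vspace V}, (W <= U)%VS ->
     (forall x w, w \in W -> act x w \in W) -> W = 0%VS \/ W = U) ->
  irreducible_repr sub_repr.
Proof.
move=> U0 minU; split=> [|S Sst]; first by rewrite lt0n dimv_eq0.
pose f := linfun sub_val.
have fE v : f v = sub_val v by rewrite lfunE.
have f0 : lker f == 0%VS by apply/lker0P => v w; rewrite !fE => /sub_val_inj.
have [] := minU (f @: S)%VS.
- by apply/subvP=> _ /memv_imgP[v _ ->]; rewrite fE sub_val_mem.
- move=> x _ /memv_imgP[v vS ->]; rewrite fE -sub_valM -fE.
  by rewrite memv_img // Sst.
- by move/eqP; rewrite -(limg0 f) eq_limg_ker0 // => /eqP; left.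
move=> fS; right; apply/eqP; rewrite eqEsubv subvf; apply/subvP=> v _.
have: f v \in (f @: S)%VS by rewrite fS fE sub_val_mem.
by case/memv_imgP=> w wS; rewrite !fE => /sub_val_inj->.
Qed.

End StableSubspace.

Section Wedderburn.
Variables (K : fieldType) (E : falgType K).

Section Intertwiner.
Variables (n m : nat) (rho : {lrmorphism E -> 'M[K]_n}).
Variable sigma : {lrmorphism E -> 'M[K]_m}.

Lemma trace_intertwined (T : 'M_(m, n)) T' x : T *m T' = 1%:M ->
    T' *m T = 1%:M -> T *m rho x = sigma x *m T ->
  \tr (sigma x) = \tr (rho x).
Proof.
move=> TT' T'T Tx.
by rewrite -[sigma x]mulmx1 -TT' mulmxA -Tx mxtrace_mulC mulmxA T'T mul1mx.
Qed.

Hypothesis irr_rho : irreducible_repr rho.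
Hypothesis irr_sigma : irreducible_repr sigma.
Hypothesis rho_surj : forall M, exists x, rho x = M.
Hypothesis ker_sub : forall x, rho x = 0 -> sigma x = 0.

(** If sigma factors through the full matrix algebra rho(E), it is isomorphic
    to rho. Elements q j mapped by rho to the matrix units of one column span a
    copy of the module of rho inside the regular module; sending q j to sigma
    (q j) w, for a suitable vector w, is the isomorphism. Applied to rho
    composed with an automorphism this is the Skolem-Noether theorem. *)
Lemma irr_intertwiner : exists (T : 'M_(m, n)) (T' : 'M_(n, m)),
  [/\ T *m T' = 1%:M, T' *m T = 1%:M & forall x, T *m rho x = sigma x *m T].
Proof.
have [n0 _] := irr_rho; have [m0 _] := irr_sigma.
pose i0 := Ordinal n0.
have [q qE] := choice (fun i => rho_surj (delta_mx i i0)).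
have [r rE] := choice (fun i => rho_surj (delta_mx i0 i)).
have eq_sigma x y : rho x = rho y -> sigma x = sigma y.
  move=> xy; apply/eqP; rewrite -subr_eq0 -linearB /=.
  by rewrite ker_sub // linearB /= xy subrr.
have q0 : sigma (q i0) != 0.
  apply/eqP=> q0; have s1 : sigma 1 = 0.
    rewrite (eq_sigma 1 (\sum_i q i * q i0 * r i)).
      rewrite linear_sum big1 // => i _.
      by rewrite /= !reprM q0 mulmx0 mul0mx.
    rewrite repr1 linear_sum mx1_sum_delta; apply: eq_bigr => i _ /=.
    by rewrite !reprM !qE rE !mul_delta_mx.
  move: s1; rewrite repr1 => /matrixP/(_ (Ordinal m0) (Ordinal m0))/eqP.
  by rewrite !mxE eqxx oner_eq0.
have [w w0] : exists w : 'cV_m, sigma (q i0) *m w != 0.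
  apply: contrapT => noW; case/eqP: q0; apply: eq_mulmx_cV => w.
  by rewrite mul0mx; apply/eqP/negPn/negP => ?; apply: noW; exists w.
pose T : 'M_(m, n) := \matrix_(i, j) (sigma (q j) *m w) i 0.
have Td j : T *m delta_mx j (0 : 'I_1) = sigma (q j) *m w.
  by rewrite -colE; apply/matrixP=> i k; rewrite (ord1 k) !mxE.
have colT x : T *m rho x = sigma x *m T.
  apply: eq_mulmx_cV => v; rewrite [v]matrix_sum_delta !mulmx_sumr.
  apply: eq_bigr => j _; rewrite big_ord1 -!scalemxAr; congr (_ *: _).
  rewrite -mulmxA -[RHS]mulmxA Td [RHS]mulmxA -reprM.
  rewrite (eq_sigma (x * q j) (\sum_i rho x i j *: q i)); last first.
    rewrite reprM qE linear_sum; apply/matrixP=> k l; rewrite summxE.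
    rewrite mxE; under eq_bigr do rewrite mxE.
    under [RHS]eq_bigr do rewrite linearZ /= qE !mxE.
    rewrite (bigD1 j) //= big1 => [|i ij]; last by rewrite (negPf ij) mulr0.
    rewrite (bigD1 k) //= big1 => [|i ij]; last first.
      by rewrite eq_sym (negPf ij) mulr0.
    by rewrite !eqxx !addr0.
  rewrite linear_sum mulmx_suml -colE [col j _]matrix_sum_delta mulmx_sumr.
  apply: eq_bigr => i _; rewrite big_ord1 -scalemxAr Td linearZ /=.
  by rewrite -scalemxAl mxE.
have Tinj (v : 'cV_n) : T *m v = 0 -> v = 0.
  move=> Tv; apply/eqP/negPn/negP => v0.
  have [y yv] := irr_cyclic irr_rho (delta_mx i0 0) v0.
  by case/eqP: w0; rewrite -Td -yv mulmxA colT -mulmxA Tv mulmx0.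
have /choice[R RE] (i : 'I_m) : exists v, T *m v = delta_mx i (0 : 'I_1).
  have [y <-] := irr_cyclic irr_sigma (delta_mx i 0) w0.
  by exists (rho y *m delta_mx i0 0); rewrite mulmxA colT -mulmxA Td.
pose T' : 'M_(n, m) := \matrix_(i, j) R j i 0.
have TT' : T *m T' = 1%:M.
  apply/matrixP=> i j; have /matrixP/(_ i 0) := RE j.
  by rewrite !mxE eqxx andbT => <-; apply: eq_bigr => k _; rewrite [T' _ _]mxE.
exists T, T'; split=> //; apply: eq_mulmx_cV => v; apply/eqP; rewrite -subr_eq0.
by apply/eqP/Tinj; rewrite mulmxBr !mulmxA TT' mul1mx mulmx1 subrr.
Qed.

End Intertwiner.
End Wedderburn.

(** * Central idempotents of a split semisimple algebra *)

Lemma big_fset_only (T : choiceType) (M : nmodType) (X : {fset T})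
    (F : T -> M) x :
  x \in X -> (forall y, y \in X -> y <> x -> F y = 0) ->
  \sum_(y <- X) F y = F x.
Proof.
move=> xX F0; rewrite (bigD1_seq x) ?fset_uniq //= big_seq_cond big1 ?addr0 //.
by move=> y /andP[yX /eqP yx]; apply: F0.
Qed.

Lemma big_fset_reindex (T : choiceType) (M : nmodType) (X : {fset T})
    (h : T -> T) (F : T -> M) :
  {in X, forall x, h x \in X} -> {in X &, injective h} ->
  \sum_(x <- X) F (h x) = \sum_(x <- X) F x.
Proof.
move=> hX hI; have um : uniq [seq h x | x <- X].
  by rewrite map_inj_in_uniq ?fset_uniq.
rewrite -(big_map h predT F) /=; apply: perm_big; apply: uniq_perm => //.
have sub : {subset [seq h x | x <- X] <= X} by move=> _ /mapP[x xX ->];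
  apply: hX.
by have [|] := uniq_min_size um sub; rewrite ?size_map.
Qed.

Section SplitSemisimple.
Variables (K : fieldType) (E : falgType K).
Implicit Types (e f x : E) (chi psi : E -> K).
Hypotheses (ssE : semisimple E) (spE : split_algebra E).

(** Write 1 = n + w along a complement W of N. Then x = x w for x in N, so N
    lies in W as well and is zero. *)
Lemma square_zero_left_ideal (N : {vspace E}) : left_ideal N ->
  {in N &, forall x y, x * y = 0} -> N = 0%VS.
Proof.
move=> idN NN; have [W [idW NW1 NW0]] := ssE idN.
have /memv_addP[n nN [w wW n1]]: 1 \in (N + W)%VS by rewrite NW1 memvf.
apply/eqP; rewrite -subv0; apply/subvP => x xN.
rewrite -NW0 memv_cap xN -[x]mulr1 n1 mulrDr NN // add0r.
by move/left_idealP: idW; apply.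
Qed.

(** Decompose 1 = i + e along the kernel I of rho and a complementary left
    ideal. Then i is a right identity of I, and e is central because the
    remaining obstruction e E i is a left ideal of square zero. *)
Lemma block_idempotent n (rho : {lrmorphism E -> 'M[K]_n}) :
  exists e, [/\ central_idempotent e, rho e = 1%:M &
                forall x, rho x = 0 -> x * e = 0].
Proof.
pose I := lker (linfun rho).
have inI x : (x \in I) = (rho x == 0) by rewrite memv_ker lfunE.
have idI : left_ideal I.
  apply/left_idealP=> x y; rewrite !inI reprM => /eqP->.
  by rewrite mulmx0.
have [W [idW IW1 IW0]] := ssE idI.
have /memv_addP[i iI [e eW i1]]: 1 \in (I + W)%VS by rewrite IW1 memvf.
have ie : i = 1 - e by rewrite i1 addrK.
have Ie x : x \in I -> x * e = 0.
  move=> xI; apply/eqP; rewrite -memv0 -IW0 memv_cap.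
  move/left_idealP: idW => ->; rewrite // andbT.
  by rewrite inI reprM; move: xI; rewrite inI => /eqP->; rewrite mul0mx.
have ee : e * e = e.
  by apply/eqP; rewrite -subr_eq0 -[X in _ - X]mul1r -mulrBl -opprB mulNr -ie
    Ie ?oppr0.
have rhoe : rho e = 1%:M.
  apply/eqP; rewrite eq_sym -subr_eq0 -(repr1 rho) -linearB /= -ie -inI //.
have exe y : y * e = e * y * e.
  apply/eqP; rewrite -subr_eq0 -mulrBl -[y in y - _]mul1r -mulrBl.
  by rewrite Ie // inI reprM linearB /= rhoe repr1 subrr mul0mx.
(* The space e E i, which measures the failure of e to be central. *)
pose N := ((amulr i \o amull e) @: fullv)%VS.
have memN x : x \in N -> exists y, x = e * y * i.
  by case/memv_imgP=> y _ ->; exists y; rewrite comp_lfunE !lfunE.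
have Nmem y : e * y * i \in N.
  by apply/memv_imgP; exists y; rewrite ?memvf // comp_lfunE !lfunE.
have N0 : N = 0%VS.
  apply: square_zero_left_ideal => [|_ _ /memN[x ->] /memN[y ->]].
    apply/left_idealP=> x _ /memN[y ->].
    by rewrite 2!mulrA exe -2!(mulrA e) Nmem.
  by rewrite -!mulrA (mulrA i) Ie // mul0r !mulr0.
exists e; split=> //; last by move=> x x0; rewrite Ie // inI x0.
split=> // y; rewrite [RHS]exe; apply/eqP; rewrite -subr_eq0.
by rewrite -[X in X - _]mulr1 -mulrBr -ie -memv0 -N0 Nmem.
Qed.

Lemma central_scalar n (rho : {lrmorphism E -> 'M[K]_n}) z :
  irreducible_repr rho -> central z -> exists c, rho z = c%:M.
Proof.
move=> irr cz; apply/is_scalar_mxP/(spE irr) => x.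
by rewrite -!reprM cz.
Qed.

Lemma central_idempotent_scalar n (rho : {lrmorphism E -> 'M[K]_n}) e :
  irreducible_repr rho -> central_idempotent e -> rho e = 0 \/ rho e = 1%:M.
Proof.
move=> irr [ce ee]; have [c rc] := central_scalar irr ce.
have := congr1 rho ee; rewrite reprM rc -scalar_mxM.
have [n0 _] := irr => /matrixP/(_ (Ordinal n0) (Ordinal n0)).
rewrite !mxE eqxx => /eqP; rewrite -subr_eq0 -[X in _ - X]mul1r -mulrBl
  mulf_eq0.
by rewrite subr_eq0 => /orP[]/eqP->; [right|left; rewrite raddf0].
Qed.

Lemma scalar1_neq0 n : (0 < n)%N -> 1%:M != 0 :> 'M[K]_n.
Proof.
move=> n0; apply/eqP => /matrixP/(_ (Ordinal n0) (Ordinal n0))/eqP.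
by rewrite !mxE eqxx oner_eq0.
Qed.

Lemma block_idempotent_primitive n (rho : {lrmorphism E -> 'M[K]_n}) e :
    irreducible_repr rho -> central_idempotent e -> rho e = 1%:M ->
    (forall x, rho x = 0 -> x * e = 0) ->
  central_primitive_idempotent e.
Proof.
move=> irr ie re ke; split=> // [|f idf fe].
  apply/eqP => e0; have := scalar1_neq0 irr.1.
  by rewrite -re e0 linear0 eqxx.
have [f0|f1] := central_idempotent_scalar irr idf.
  by left; rewrite -fe ke.
right; apply/eqP; rewrite eq_sym -subr_eq0 -fe -[X in X - _]mul1r -mulrBl.
by rewrite ke // linearB /= f1 repr1 subrr.
Qed.

(** Characters of irreducible representations do not vanish, even when the
    characteristic divides the degree: some element maps to a matrix unit. *)
Lemma irr_char_neq0 n (rho : {lrmorphism E -> 'M[K]_n}) :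
  irreducible_repr rho -> exists x, \tr (rho x) = 1.
Proof.
move=> irr; have [n0 _] := irr.
have [x xE] := irr_surjective irr (spE irr) (delta_mx (Ordinal n0)
  (Ordinal n0)).
exists x; rewrite xE /mxtrace (bigD1 (Ordinal n0)) //= !mxE eqxx big1 ?addr0 //.
by move=> i i0; rewrite !mxE (negPf i0).
Qed.

Lemma cpi_mul e f : central_primitive_idempotent e ->
  central_primitive_idempotent f -> e * f != 0 -> e = f.
Proof.
move=> [[ce ee] e0 pe] [[cf ff] f0 pf] ef0.
have idef : central_idempotent (e * f).
  split=> [x|]; first by rewrite -mulrA cf mulrA ce mulrA.
  by rewrite mulrA -(mulrA e) cf !mulrA ee -mulrA ff.
have eff : e * f * f = e * f by rewrite -mulrA ff.
have efe : e * f * e = e * f by rewrite ce -mulrA ee.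
have [/eqP|<-] := pf _ idef eff; first by rewrite (negPf ef0).
by have [/eqP|->] := pe _ idef efe; first by rewrite (negPf ef0).
Qed.

(** If e and f differ they are orthogonal, so sigma e = 0; computing the common
    character at e x through rho and through sigma then shows that it
    vanishes. *)
Lemma afforded_idempotent_unique chi n (rho : {lrmorphism E -> 'M[K]_n})
    m (sigma : {lrmorphism E -> 'M[K]_m}) e f :
    irreducible_repr rho -> affords rho chi -> affords sigma chi ->
    central_primitive_idempotent e -> central_primitive_idempotent f ->
    rho e = 1%:M -> sigma f = 1%:M -> e = f.
Proof.
move=> irr rchi schi pe pf re sf; apply: cpi_mul => //; apply/eqP => ef0.
have se : sigma e = 0 by rewrite -[sigma e]mulmx1 -sf -reprM ef0 linear0.
have [x /eqP] := irr_char_neq0 irr.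
rewrite -[rho x]mul1mx -re -reprM -rchi schi reprM se mul0mx linear0.
by rewrite eq_sym oner_eq0.
Qed.

(** This is the form in which [idem] is used: the last clause says that e(chi)
    E meets the kernel of rho trivially. *)
Lemma idemP chi n (rho : {lrmorphism E -> 'M[K]_n}) :
  irreducible_repr rho -> affords rho chi ->
  [/\ central_primitive_idempotent (idem chi), rho (idem chi) = 1%:M &
      forall x, rho x = 0 -> x * idem chi = 0].
Proof.
move=> irr rchi; have [e [ie re ke]] := block_idempotent rho.
have pe := block_idempotent_primitive irr ie re ke.
suff -> : idem chi = e by [].
apply: xget_unique => [|f [pf [m [sigma [irs schi sf]]]]].
  by split=> //; exists n, rho.
exact: (afforded_idempotent_unique irs schi rchi).
Qed.

Lemma IrrP chi : Irr E chi -> exists n (rho : {lrmorphism E -> 'M[K]_n}),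
  [/\ irreducible_repr rho, affords rho chi, rho (idem chi) = 1%:M,
      forall x, rho x = 0 -> x * idem chi = 0 & forall M, exists x, rho x = M].
Proof.
move=> [n [rho [irr rchi]]]; have [_ re ke] := idemP irr rchi.
by exists n, rho; split=> //; apply: irr_surjective irr (spE irr).
Qed.

Lemma idem_cpi chi : Irr E chi -> central_primitive_idempotent (idem chi).
Proof. by move=> [n [rho [irr rchi]]]; have [] := idemP irr rchi. Qed.

Lemma idem_central chi x : Irr E chi -> idem chi * x = x * idem chi.
Proof. by move=> /idem_cpi[[] ]. Qed.

Lemma idem_idem chi : Irr E chi -> idem chi * idem chi = idem chi.
Proof. by move=> /idem_cpi[[] ]. Qed.

Lemma idem_neq0 chi : Irr E chi -> idem chi != 0.
Proof. by move=> /idem_cpi[]. Qed.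

Lemma idem_affords chi n (rho : {lrmorphism E -> 'M[K]_n}) : Irr E chi ->
  irreducible_repr rho -> rho (idem chi) = 1%:M -> affords rho chi.
Proof.
move=> /IrrP[m [sigma [irs schi _ ks surj]]] irr re x.
have ker_sub y : sigma y = 0 -> rho y = 0.
  by move=> /ks ye; rewrite -[rho y]mulmx1 -re -reprM ye linear0.
have [T [T' [TT' T'T Tx]]] := irr_intertwiner irs irr surj ker_sub.
by rewrite schi (trace_intertwined TT' T'T (Tx x)).
Qed.

Lemma idem_inj chi psi : Irr E chi -> Irr E psi -> idem chi = idem psi ->
  chi = psi.
Proof.
move=> Ichi /IrrP[n [rho [irr rpsi re _ _]]] ee; apply/funext => x.
by rewrite rpsi (idem_affords Ichi irr) // ee.
Qed.

Lemma idem_orth chi psi : Irr E chi -> Irr E psi -> chi <> psi ->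
  idem chi * idem psi = 0.
Proof.
move=> Ichi Ipsi neq; apply/eqP/negPn/negP => ne0; apply: neq.
by apply: idem_inj => //; apply: cpi_mul => //; apply: idem_cpi.
Qed.

Lemma irr_mul_idem chi e : Irr E chi -> central_idempotent e ->
  idem chi * e = 0 \/ idem chi * e = idem chi.
Proof.
move=> Ichi [ce ee]; have [[cc cE] _] := idem_cpi Ichi; apply.
  split=> [x|]; first by rewrite -mulrA ce mulrA cc mulrA.
  by rewrite mulrA -(mulrA _ e) ce !mulrA cE -mulrA ee.
by rewrite -mulrA ce mulrA cE.
Qed.

(** The idempotents of distinct characters are linearly independent, being
    nonzero and orthogonal, so there are at most dim E of them. *)
Lemma Irr_finite : finite_set (Irr E).
Proof.
apply: contrapT => /(infinite_set_fset (\dim {:E}).+1)[X XI].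
apply/negP; rewrite -leqNgt.
pose s := [seq idem chi | chi <- X].
rewrite -[#|` X|](size_map (@idem K E)) -/s.
suff frs : free (in_tuple s).
  rewrite -[size s](eqnP frs); exact/dimvS/subvf.
apply/freeP => k k0 i.
have szX : size X = size s by rewrite size_map.
pose c j := nth (fun=> 0) X j.
have cI (j : 'I_(size s)) : Irr E (c j).
  by apply: XI; rewrite /= mem_nth // szX.
have sE (j : 'I_(size s)) : (in_tuple s)`_j = idem (c j).
  by rewrite (nth_map (fun=> 0)) // szX.
have := congr1 ( *%R (idem (c i))) k0.
rewrite mulr0 mulr_sumr (bigD1 i) //= big1 ?addr0 => [|j ji].
  rewrite sE -scalerAr idem_idem // => /eqP.
  by rewrite scaler_eq0 (negPf (idem_neq0 _)) // orbF => /eqP.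
rewrite sE -scalerAr idem_orth ?scaler0 // => /eqP.
rewrite nth_uniq ?szX ?fset_uniq // => /eqP/val_inj/esym/eqP.
by rewrite (negPf ji).
Qed.

Lemma minimal_left_ideal (J : {vspace E}) : left_ideal J -> J != 0%VS ->
  exists U : {vspace E}, [/\ left_ideal U, (U <= J)%VS, U != 0%VS &
    forall W, left_ideal W -> (W <= U)%VS -> W = 0%VS \/ W = U].
Proof.
move=> idJ J0.
pose P d := `[< exists U, [/\ left_ideal U, (U <= J)%VS,
  U != 0%VS & \dim U = d]>].
have exP : exists d, P d by exists (\dim J); apply/asboolP; exists J; split.
have [d /asboolP[U [idU UJ U0 dU]] dmin] := ex_minnP exP.
exists U; split=> // W idW WU; have [->|W0] := eqVneq W 0%VS; first by left.
right; apply/eqP; rewrite -(geq_leqif (dimv_leqif_eq WU)) dU; apply: dmin.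
by apply/asboolP; exists W; split=> //; apply: subv_trans UJ.
Qed.

Lemma mem_Irr chi : (chi \in fset_set (Irr E)) = (chi \in Irr E).
Proof. by rewrite in_fset_set //; apply: Irr_finite. Qed.

Lemma sum_idem_central_idempotent (X : {fset E -> K}) :
  {in X, forall chi, Irr E chi} ->
  central_idempotent (\sum_(chi <- X) idem chi).
Proof.
move=> XI; split=> [x|]; rewrite !big_seq.
  rewrite mulr_suml mulr_sumr; apply: eq_bigr => chi.
  by move=> /XI Ichi; rewrite idem_central.
rewrite mulr_suml; apply: eq_bigr => chi chiX; have Ichi := XI _ chiX.
rewrite -big_seq mulr_sumr (big_fset_only chiX) ?idem_idem // =>
  psi /XI Ipsi neq.
by rewrite idem_orth // => /esym.
Qed.

(** If f = 1 - sum of all e(chi) were nonzero, a minimal left ideal inside E f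
    would be an irreducible representation on which f acts as 1; but f is
    killed by the idempotent of its character, which also acts as 1. *)
Lemma idem_sum_all : \sum_(chi <- fset_set (Irr E)) idem chi = 1.
Proof.
have [cs ss] : central_idempotent (\sum_(chi <- fset_set (Irr E)) idem chi).
  apply: sum_idem_central_idempotent => chi.
  by rewrite mem_Irr => /set_mem.
set s := \sum_(chi <- _) _ in cs ss *; pose f := 1 - s.
suff : f = 0 by move/subr0_eq.
have ef chi : Irr E chi -> idem chi * f = 0.
  move=> Ichi; have chiX : chi \in fset_set (Irr E) by rewrite mem_Irr inE.
  rewrite mulrBr mulr1 mulr_sumr (big_fset_only chiX) ?idem_idem ?subrr // =>
    psi.
  by rewrite mem_Irr => /set_mem Ipsi neq; rewrite idem_orth // => /esym.
have cf : central f by move=> x; rewrite mulrBl mulrBr cs mul1r mulr1.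
have ff : f * f = f by rewrite mulrBl mul1r mulrBr mulr1 ss subrr subr0.
apply/eqP/negPn/negP => f0.
pose J := (amulr f @: fullv)%VS.
have memJ x : x \in J -> x * f = x.
  by case/memv_imgP=> y _ ->; rewrite lfunE /= -mulrA ff.
have idJ : left_ideal J.
  apply/left_idealP=> x y yJ; apply/memv_imgP; exists (x * y).
    exact: memvf.
  by rewrite lfunE /= -mulrA memJ.
have J0 : J != 0%VS.
  apply: contra f0 => /eqP J0; rewrite -memv0 -J0.
  by apply/memv_imgP; exists f; rewrite ?memvf // lfunE.
have [U [/left_idealP idU UJ U0 minU]] := minimal_left_ideal idJ J0.
have linl v : linear ( *%R^~ v : E -> E) by move=> k x y;
  rewrite mulrDl scalerAl.
have linr x : linear ( *%R x : E -> E) by move=> k y z; rewrite mulrDr scalerAr.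
have assoc x y z : (x * y) * z = x * (y * z) :> E by rewrite mulrA.
have one : {in U, forall v, 1 * v = v} by move=> v _; rewrite mul1r.
pose rho := sub_repr linl linr assoc one idU.
have irr : irreducible_repr rho.
  apply: sub_repr_irr => // W WU idW; apply: minU => //.
  exact/left_idealP.
have rf : rho f = 1%:M.
  apply: eq_mulmx_cV => v; apply: (@sub_val_inj _ _ U).
  rewrite sub_valM mul1mx cf memJ //; apply: (subvP UJ); exact: sub_val_mem.
pose psi x := \tr (rho x).
have rpsi : affords rho psi by [].
have Ipsi : Irr E psi by exists _, rho.
have [_ re _] := idemP irr rpsi.
have := scalar1_neq0 (proj1 irr).
by rewrite -rf -[rho f]mul1mx -re -reprM ef // linear0 eqxx.
Qed.

End SplitSemisimple.

(** * Dimensions, trace forms and Schur elements of blocks *)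

Section Blocks.
Variables (K : fieldType) (E : falgType K).
Implicit Types (e f x : E) (chi psi : E -> K).

(** The left ideal E e. *)
Definition lideal e : {vspace E} := (amulr e @: fullv)%VS.

Lemma lidealP e x : e * e = e -> reflect (x * e = x) (x \in lideal e).
Proof.
move=> ee; apply: (iffP idP) => [|xe].
  by case/memv_imgP=> y _ ->; rewrite lfunE /= -mulrA ee.
by apply/memv_imgP; exists x; rewrite ?memvf // lfunE /= xe.
Qed.

Lemma dim_lidealD e f : e * e = e -> f * f = f -> e * f = 0 -> f * e = 0 ->
  \dim (lideal (e + f)) = (\dim (lideal e) + \dim (lideal f))%N.
Proof.
move=> ee ff ef fe.
have efef : (e + f) * (e + f) = e + f.
  by rewrite mulrDl !mulrDr ee ff ef fe addr0 add0r.
rewrite -dimv_disjoint_sum; last first.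
  apply/eqP; rewrite -subv0; apply/subvP=> x /memv_capP[/(lidealP _ ee) xe].
  by move/(lidealP _ ff); rewrite -xe -mulrA ef mulr0 memv0 => <-.
congr (\dim _); apply/eqP; rewrite eqEsubv; apply/andP; split; apply/subvP=> x.
  move/(lidealP _ efef); rewrite mulrDr => <-; apply: memv_add.
    by apply/(lidealP _ ee); rewrite -mulrA ee.
  by apply/(lidealP _ ff); rewrite -mulrA ff.
case/memv_addP=> u /(lidealP _ ee) ue [v /(lidealP _ ff) vf ->];
  apply/(lidealP _ efef).
rewrite -ue -vf mulrDl !mulrDr -!mulrA ee ff ef fe.
by rewrite !mulr0 addr0 add0r.
Qed.

Lemma dim_lideal_sum (T : eqType) (r : seq T) (F : T -> E) : uniq r ->
    {in r, forall i, F i * F i = F i} ->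
    {in r &, forall i j, i != j -> F i * F j = 0} ->
  \dim (lideal (\sum_(i <- r) F i)) = (\sum_(i <- r) \dim (lideal (F i)))%N.
Proof.
elim: r => [|i r IHr] /=.
  rewrite !big_nil => _ _ _; apply/eqP; rewrite dimv_eq0 -subv0.
  by apply/subvP=> x /(lidealP _ (mulr0 0)); rewrite mulr0 memv0 => <-.
case/andP=> ir ur FF Fo; rewrite !big_cons.
have Fi : F i * F i = F i by apply: FF; rewrite mem_head.
have subr j : j \in r -> j \in i :: r by rewrite inE => ->; rewrite orbT.
have ij j : j \in r -> i != j by apply: contraTneq => <-.
rewrite dim_lidealD // ?IHr //.
- by move=> j /subr; apply: FF.
- by move=> j k /subr jr /subr kr; apply: Fo.
- rewrite big_seq mulr_suml; apply: eq_bigr => j jr; rewrite -big_seq mulr_sumr.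
  rewrite (bigD1_seq j) //= big_seq_cond big1 ?addr0 ?FF ?subr //.
  by move=> k /andP[kr kj]; apply: Fo; rewrite ?subr // eq_sym.
- rewrite big_seq mulr_sumr big1 // => j jr.
  by rewrite Fo ?mem_head ?subr ?ij.
- rewrite big_seq mulr_suml big1 // => j jr.
  by rewrite Fo ?mem_head ?subr // eq_sym ij.
Qed.

Hypotheses (ssE : semisimple E) (spE : split_algebra E).

(** The representation maps E e(chi) bijectively onto the matrix algebra. *)
Lemma dim_lideal_idem chi n (rho : {lrmorphism E -> 'M[K]_n}) :
  irreducible_repr rho -> affords rho chi ->
    \dim (lideal (idem chi)) = (n * n)%N.
Proof.
move=> irr rchi; have [[[ce ee] _ _] re ke] := idemP ssE spE irr rchi.
have : (lideal (idem chi) :&: lker (linfun rho))%VS = 0%VS.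
  apply/eqP; rewrite -subv0; apply/subvP=> x /memv_capP[/(lidealP _ ee) xe].
  by rewrite memv_ker lfunE /= memv0 => /eqP/ke; rewrite xe => ->.
move/limg_dim_eq<-; rewrite -[RHS](dim_matrix K n n) -dimvf; congr (\dim _).
apply/eqP; rewrite eqEsubv subvf; apply/subvP=> M _.
have [x <-] := irr_surjective irr (spE irr) M.
apply/memv_imgP; exists (x * idem chi).
  by apply/(lidealP _ ee); rewrite -mulrA ee.
by rewrite lfunE /= reprM re mulmx1.
Qed.

Section TraceForm.
Variable t : {scalar E}.
Hypothesis tC : forall x y, t (x * y) = t (y * x).

(** A trace form restricted to the block factors through a matrix algebra, and
    there its values on matrix units are 0 off the diagonal and constant on
    it. *)
Lemma trace_form_block chi : Irr E chi ->
  exists c, forall x, t (idem chi * x) = c * chi x.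
Proof.
move=> Ichi; have [n [rho [irr rchi re ke surj]]] := IrrP ssE spE Ichi.
have ce x : idem chi * x = x * idem chi by apply: idem_central.
pose i0 := Ordinal (proj1 irr).
have /choice[p pE] (ij : 'I_n * 'I_n) := surj (delta_mx ij.1 ij.2).
have eq_t x y : rho x = rho y -> t (idem chi * x) = t (idem chi * y).
  move=> xy; congr (t _); apply/eqP; rewrite -subr_eq0 -mulrBr ce.
  by rewrite ke // linearB /= xy subrr.
pose q i j := idem chi * p (i, j).
have tp i j : t (q i j) = if i == j then t (q i0 i0) else 0.
  have -> : t (q i j) = t (idem chi * (p (i, i0) * p (i0, j))).
    by apply: eq_t; rewrite reprM !pE mul_delta_mx.
  rewrite mulrA tC mulrA -ce -mulrA.
  rewrite (eq_t _ (if i == j then p (i0, i0) else 0)); last first.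
    rewrite reprM !pE mul_delta_mx_cond eq_sym.
    by case: eqP => _ /=; rewrite ?pE ?linear0.
  by case: eqP => _; rewrite // mulr0 linear0.
exists (t (q i0 i0)) => x.
rewrite (eq_t x (\sum_i \sum_j rho x i j *: p (i, j))); last first.
  rewrite linear_sum [LHS]matrix_sum_delta; apply: eq_bigr => i _.
  by rewrite linear_sum; apply: eq_bigr => j _; rewrite linearZ /= pE.
rewrite mulr_sumr linear_sum rchi mulr_sumr; apply: eq_bigr => i _.
rewrite mulr_sumr linear_sum (bigD1 i) //= big1 ?addr0 => [|j ji].
  by rewrite -scalerAr linearZ /= -/(q i i) tp eqxx mulrC.
by rewrite -scalerAr linearZ /= -/(q i j) tp eq_sym (negPf ji) mulr0.
Qed.

Hypothesis t_nondeg : forall x, (forall y, t (x * y) = 0) -> x = 0.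

(** Since t is c times chi on the block, the element dual to chi is e(chi) /
    c. *)
Lemma schur_elementE chi c : Irr E chi ->
    (forall x, t (idem chi * x) = c * chi x) ->
  c != 0 /\ schur_element t chi = c^-1.
Proof.
move=> Ichi tc; have [n [rho [irr rchi re ke surj]]] := IrrP ssE spE Ichi.
have c0 : c != 0.
  apply/eqP=> c0; case/eqP: (idem_neq0 ssE spE Ichi); apply: t_nondeg => x.
  by rewrite tc c0 mul0r.
have dE : dual_element t chi = c^-1 *: idem chi.
  have dt x : t ((c^-1 *: idem chi) * x) = chi x.
    by rewrite -scalerAl linearZ /= tc mulKf.
  apply: xget_unique => [|z [_ zt]].
    by split=> // x; rewrite -scalerAl -scalerAr idem_central.
  apply/eqP; rewrite -subr_eq0; apply/eqP; apply: t_nondeg => x.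
  by rewrite mulrBl linearB /= zt dt subrr.
split=> //; rewrite /schur_element dE.
have rs m (sigma : {lrmorphism E -> 'M[K]_m}) : irreducible_repr sigma ->
    affords sigma chi -> sigma (c^-1 *: idem chi) = (c^-1)%:M.
  move=> irs schi; have [_ se _] := idemP ssE spE irs schi.
  by rewrite linearZ /= se scalemx1.
apply: xget_unique => [|d [m [sigma [irs schi]]]].
  by exists n, rho; split=> //; apply: rs.
rewrite (rs _ _ irs schi) => /matrixP/(_ (Ordinal irs.1) (Ordinal irs.1)).
by rewrite !mxE eqxx.
Qed.

End TraceForm.
End Blocks.

(** * Characters and idempotents under automorphisms *)

Section Automorphisms.
Variables (K : fieldType) (E : falgType K) (s s' : E -> E).
Hypotheses (ssE : semisimple E) (spE : split_algebra E).
Hypotheses (s_lin : linear s) (s_mon : monoid_morphism s).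
Hypotheses (s'_lin : linear s') (s'_mon : monoid_morphism s').
Hypotheses (sK : cancel s s') (s'K : cancel s' s).

Lemma precomp_repr n (rho : {lrmorphism E -> 'M[K]_n}) :
    irreducible_repr rho -> forall (u : E -> E), linear u ->
    monoid_morphism u -> (forall x, exists y, u y = x) ->
  exists2 rho' : {lrmorphism E -> 'M[K]_n},
    irreducible_repr rho' & rho' =1 rho \o u.
Proof.
move=> [n0 irr] u u_lin [u1 uM] u_surj.
have f_lin : linear (rho \o u) by move=> k x y /=; rewrite u_lin linearP.
have f_mon : monoid_morphism (rho \o u).
  by split=> [|x y] /=; rewrite ?u1 ?uM ?rmorph1 ?rmorphM.
exists (mk_repr f_lin f_mon) => //; split=> // U Ust; apply: irr => x v vU.
by have [y <-] := u_surj x; apply: (Ust y).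
Qed.

Lemma Irr_precomp chi : Irr E chi -> Irr E (chi \o s).
Proof.
move=> [n [rho [irr rchi]]].
have [|rho' irr' rho'E] := precomp_repr irr s_lin s_mon.
  by move=> x; exists (s' x).
by exists n, rho'; split=> // x; rewrite rho'E /= rchi.
Qed.

Let morph_central_idempotent (u u' : E -> E) e : linear u ->
  monoid_morphism u -> cancel u' u -> central_idempotent e ->
  central_idempotent (u e).
Proof.
move=> u_lin [u1 uM] u'K [ce ee]; split=> [x|]; last by rewrite -uM ee.
by rewrite -[x]u'K -!uM ce.
Qed.

(** Both idempotents are primitive and each acts as 1 in the representation
    composed with s, so each absorbs the other. *)
Lemma idem_precomp chi : Irr E chi -> s (idem (chi \o s)) = idem chi.
Proof.
move=> Ichi; have Ichi' := Irr_precomp Ichi.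
have [n [rho [irr rchi re _ _]]] := IrrP ssE spE Ichi.
have [|rho' irr' rho'E] := precomp_repr irr s_lin s_mon.
  by move=> x; exists (s' x).
have [cpi' re' _] : [/\ central_primitive_idempotent (idem (chi \o s)),
    rho' (idem (chi \o s)) = 1%:M & forall x, rho' x = 0 ->
      x * idem (chi \o s) = 0].
  by apply: (idemP ssE spE irr') => x; rewrite rho'E /= rchi.
have [n0 _] := irr.
have [ide _ _] := idem_cpi ssE spE Ichi.
have [ide' _ _] := cpi'.
have cis := morph_central_idempotent s_lin s_mon s'K ide'.
have cis' := morph_central_idempotent s'_lin s'_mon sK ide.
have h1 : idem chi * s (idem (chi \o s)) = idem chi.
  have [h0|//] := irr_mul_idem ssE spE Ichi cis.
  have := scalar1_neq0 K n0; rewrite -re' rho'E /= -[rho _]mul1mx -re -reprM.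
  by rewrite h0 linear0 eqxx.
have h2 : idem (chi \o s) * s' (idem chi) = idem (chi \o s).
  have [h0|//] := irr_mul_idem ssE spE Ichi' cis'.
  have := scalar1_neq0 K n0; rewrite -re' -[rho' _]mulmx1 -[in X in _ *m X]re.
  by rewrite -[in idem chi](s'K (idem chi)) -[rho (s _)]/((rho \o s) _) -rho'E
             -reprM h0 linear0 eqxx.
have [_ sM] := s_mon.
have h3 : s (idem (chi \o s)) * idem chi = s (idem (chi \o s)).
  by rewrite -{1}(s'K (idem chi)) -sM h2.
by rewrite -h3 (proj1 cis) h1.
Qed.

End Automorphisms.

(** * Crossed products over a field and the two group actions *)

(** The group-graded structure of E over K. The last two fields make the sum of
    the B a_g direct ([homog_independent]). *)
Record crossed_product (K : fieldType) (E : falgType K) (B : {aspace E})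
    (gT : finGroupType) (a : gT -> E) (t : {scalar E}) : Prop :=
  CrossedProduct {
    cp_one : 1 \in B;
    cp_a1 : a 1%g = 1;
    cp_unit : forall g, a g \is a GRing.unit;
    cp_conj : forall g b, b \in B -> a g * b * (a g)^-1 \in B;
    cp_cocycle : forall g h, a g * a h * (a (g * h)%g)^-1 \in B;
    cp_decomp : forall x, exists c : gT -> E,
      (forall g, c g \in B) /\ x = \sum_g c g * a g;
    cp_traceC : forall x y, t (x * y) = t (y * x);
    cp_nondeg : forall x, (forall y, t (x * y) = 0) -> x = 0;
    cp_nondegB : forall x, x \in B -> {in B, forall y, t (x * y) = 0} -> x = 0;
    cp_trace0 : forall g b, g != 1%g -> b \in B -> t (b * a g) = 0 }.

Section CrossedProduct.
Variables (K : fieldType) (E : falgType K) (B : {aspace E}).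
Variables (gT : finGroupType) (a : gT -> E) (t : {scalar E}).
Hypothesis cp : crossed_product B a t.

Let B1 := cp_one cp.
Let aU := cp_unit cp.

Definition homog g x := exists2 b, b \in B & x = b * a g.

Lemma vsval1 : vsval (1 : subvs_of B) = 1.
Proof. by apply/eqP; rewrite algid_eq1 B1. Qed.

Lemma homogB b : b \in B -> homog 1 b.
Proof. by exists b; rewrite ?(cp_a1 cp) ?mulr1. Qed.

Lemma homogBa g b : b \in B -> homog g (b * a g).
Proof. by exists b. Qed.

Lemma homoga g : homog g (a g).
Proof. by exists 1; rewrite ?B1 ?mul1r. Qed.

Lemma homog1P x : homog 1 x -> x \in B.
Proof. by case=> b bB ->; rewrite (cp_a1 cp) mulr1. Qed.

Lemma homogM g h x y : homog g x -> homog h y -> homog (g * h) (x * y).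
Proof.
case=> b bB -> [c cB ->].
exists (b * (a g * c * (a g)^-1) * (a g * a h * (a (g * h)%g)^-1)).
  apply: memvM (cp_cocycle cp g h); apply: memvM => //.
  exact: (cp_conj cp).
by rewrite -!mulrA mulVr ?aU // mulr1 mulKr ?aU.
Qed.

Lemma homogV g : homog g^-1 (a g)^-1.
Proof.
pose u := a g^-1%g * a g.
have uB : u \in B.
  by have := cp_cocycle cp g^-1 g; rewrite mulVg (cp_a1 cp) invr1 mulr1.
exists u^-1; first by rewrite memvV.
by rewrite /u invrM ?aU // -mulrA mulVr ?aU // mulr1.
Qed.

Lemma conj_inv_mem g b : b \in B -> (a g)^-1 * b * a g \in B.
Proof.
move=> bB; apply: homog1P; rewrite -(mulVg g) -[g^-1%g]mulg1.
by apply: homogM (homoga g); apply: homogM (homogV g) (homogB bB).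
Qed.

Lemma trace_homog g x : g != 1%g -> homog g x -> t x = 0.
Proof. by move=> g1 [b bB ->]; apply: (cp_trace0 cp). Qed.

(** Multiplying on the left by d in B and on the right by the inverse of a_h,
    the form kills every term but the one of degree 1 and leaves t(d (c
    h)). *)
Lemma homog_independent (c : gT -> E) : (forall g, c g \in B) ->
  \sum_g c g * a g = 0 -> forall h, c h = 0.
Proof.
move=> cB c0 h; apply: (cp_nondegB cp) => // d dB; rewrite (cp_traceC cp).
have := congr1 (fun x => t (d * (x * (a h)^-1))) c0.
rewrite mul0r mulr0 linear0 mulr_suml mulr_sumr linear_sum (bigD1 h) //=.
rewrite mulrK ?aU // big1 ?addr0 // => g gh.
apply: (@trace_homog (g * h^-1)%g).
  by apply: contra gh => /eqP/(canRL (mulgKV _)); rewrite mul1g => ->.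
rewrite -[(g * _)%g]mul1g; apply: homogM (homogB dB) _.
by apply: homogM (homogV h); exists (c g).
Qed.

Definition coef x : gT -> E := sval (cid (cp_decomp cp x)).

Lemma coef_mem x g : coef x g \in B.
Proof. by rewrite /coef; case: cid => c []. Qed.

Lemma coef_sum x : x = \sum_g coef x g * a g.
Proof. by rewrite /coef; case: cid => c []. Qed.

Lemma coefE (c : gT -> E) x : (forall g, c g \in B) -> x = \sum_g c g * a g ->
  coef x =1 c.
Proof.
move=> cB xE g; apply/eqP; rewrite -subr_eq0; apply/eqP.
apply: (@homog_independent (fun g => coef x g - c g)) => [h|].
  by rewrite memvB ?coef_mem.
under eq_bigr do rewrite mulrBl.
by rewrite sumrB -coef_sum -xE subrr.
Qed.

Definition pr g x : subvs_of B := vsproj B (coef x g).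

Lemma vsval_pr g x : vsval (pr g x) = coef x g.
Proof. by rewrite vsprojK ?coef_mem. Qed.

Fact pr_linear g : linear (pr g).
Proof.
move=> k x y; apply: val_inj; rewrite /= !vsval_pr.
apply: (@coefE (fun g => k *: coef x g + coef y g)) => [h|].
  by rewrite memvD ?memvZ ?coef_mem.
rewrite {1}[x]coef_sum {1}[y]coef_sum scaler_sumr -big_split.
by apply: eq_bigr => h _; rewrite mulrDl scalerAl.
Qed.
HB.instance Definition _ g :=
  GRing.isLinear.Build K E (subvs_of B) *:%R (pr g) (pr_linear g).

Lemma pr_sum x : x = \sum_g vsval (pr g x) * a g.
Proof. by under eq_bigr do rewrite vsval_pr; apply: coef_sum. Qed.

Lemma pr_homog g h b : b \in B ->
  pr h (b * a g) = if h == g then vsproj B b else 0.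
Proof.
move=> bB; apply: val_inj; rewrite /= vsval_pr.
rewrite (@coefE (fun h => if h == g then b else 0)) => [|k|].
- by case: eqP; rewrite ?vsprojK // linear0.
- by case: eqP; rewrite ?mem0v.
rewrite (bigD1 g) //= eqxx big1 ?addr0 // => k kg.
by rewrite (negPf kg) mul0r.
Qed.

Lemma pr1B b : b \in B -> pr 1 b = vsproj B b.
Proof. by move=> bB; rewrite -[b in LHS]mulr1 -(cp_a1 cp) pr_homog // eqxx. Qed.

Lemma pr_homog0 g h x : homog g x -> h != g -> pr h x = 0.
Proof. by case=> b bB -> hg; rewrite pr_homog // (negPf hg). Qed.

Lemma homog_pr g x : homog g (vsval (pr g x) * a g).
Proof. by apply: homogBa; apply: subvsP. Qed.

Lemma homog_ext (V : lmodType K) (f f' : {linear E -> V}) :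
  (forall g x, homog g x -> f x = f' x) -> f =1 f'.
Proof.
move=> ff' x; rewrite [x]pr_sum !linear_sum; apply: eq_bigr => g _.
exact/ff'/homog_pr.
Qed.

Lemma homog_ext_scalar (f f' : E -> K) : scalar f -> scalar f' ->
  (forall g x, homog g x -> f x = f' x) -> f =1 f'.
Proof. by move=> fl fl'; apply: (@homog_ext K^o (@mk_linear K E K^o f fl)
  (@mk_linear K E K^o f' fl')). Qed.

Definition conjB g (b : subvs_of B) : subvs_of B :=
  vsproj B (a g * vsval b * (a g)^-1).
Definition conjBV g (b : subvs_of B) : subvs_of B :=
  vsproj B ((a g)^-1 * vsval b * a g).

Lemma vsval_conjB g b : vsval (conjB g b) = a g * vsval b * (a g)^-1.
Proof. by rewrite vsprojK // (cp_conj cp) ?subvsP. Qed.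

Lemma vsval_conjBV g b : vsval (conjBV g b) = (a g)^-1 * vsval b * a g.
Proof. by rewrite vsprojK // conj_inv_mem ?subvsP. Qed.

Lemma conjB_linear g : linear (conjB g).
Proof.
move=> k b c; apply: val_inj; rewrite /= !vsval_conjB /=.
by rewrite mulrDr mulrDl -scalerAr -scalerAl.
Qed.

Lemma conjBV_linear g : linear (conjBV g).
Proof.
move=> k b c; apply: val_inj; rewrite /= !vsval_conjBV /=.
by rewrite mulrDr mulrDl -scalerAr -scalerAl.
Qed.

Lemma conjBK g : cancel (conjB g) (conjBV g).
Proof.
move=> b; apply: val_inj; rewrite /= vsval_conjBV vsval_conjB.
by rewrite -!mulrA mulKr ?aU // mulVr ?aU // mulr1.
Qed.

Lemma conjBVK g : cancel (conjBV g) (conjB g).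
Proof.
move=> b; apply: val_inj; rewrite /= vsval_conjB vsval_conjBV.
by rewrite -!mulrA mulVKr ?aU // mulrV ?aU // mulr1.
Qed.

Lemma conjBV_monoid g : monoid_morphism (conjBV g).
Proof.
split=> [|b c]; apply: val_inj; rewrite /= vsval_conjBV.
  by rewrite -[algid _]/(vsval 1) vsval1 mulr1 mulVr ?aU.
by rewrite !vsval_conjBV -!mulrA mulVKr ?aU.
Qed.

Lemma conjB_monoid g : monoid_morphism (conjB g).
Proof.
split=> [|b c]; apply: val_inj; rewrite /= vsval_conjB.
  by rewrite -[algid _]/(vsval 1) vsval1 mulr1 mulrV ?aU.
by rewrite !vsval_conjB -!mulrA mulKr ?aU.
Qed.

Section ConjChar.
Hypotheses (ssB : semisimple (subvs_of B)) (spB : split_algebra (subvs_of B)).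
Implicit Type psi : subvs_of B -> K.

Lemma Irr_conjBV g psi : Irr (subvs_of B) psi ->
  Irr (subvs_of B) (psi \o conjBV g).
Proof.
exact: (@Irr_precomp K (subvs_of B) _ _ (conjBV_linear g) (conjBV_monoid g)
  (@conjBK g)).
Qed.

Lemma idem_conjBV g psi : Irr (subvs_of B) psi ->
  idem (psi \o conjBV g) = conjB g (idem psi).
Proof.
move=> Ipsi; apply: (can_inj (@conjBVK g)); rewrite conjBK.
exact: (@idem_precomp K (subvs_of B) _ _ ssB spB (conjBV_linear g)
  (conjBV_monoid g) (conjB_linear g)
          (conjB_monoid g) (@conjBVK g) (@conjBK g)).
Qed.

(** The character with idempotent a_g e(psi) a_g^-1 is obtained by conjugating
    the argument with the inverse. *)
Lemma conj_charE g psi : Irr (subvs_of B) psi ->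
  conj_char a g psi = psi \o conjBV g.
Proof.
move=> Ipsi; have Ig := Irr_conjBV g Ipsi.
have vI : vsval (idem (psi \o conjBV g)) = a g * vsval (idem psi) * (a g)^-1.
  by rewrite idem_conjBV // vsval_conjB.
apply: xget_unique => // psi' [Ipsi' vI'].
by apply: (idem_inj ssB spB) => //; apply: val_inj; rewrite /= vI.
Qed.

End ConjChar.

Section Twist.
Variable xi : gT -> K.
Hypothesis dxi : dual_group gT K xi.

(** For a linear character u this is an algebra automorphism ([theta_monoid]),
    because the product of components of degrees g and h has degree g h. *)
Definition theta (u : gT -> K) x : E := \sum_g u g *: (vsval (pr g x) * a g).

Fact theta_linear u : linear (theta u).
Proof.
move=> k x y; rewrite scaler_sumr -big_split; apply: eq_bigr => g _ /=.
by rewrite linearP /= mulrDl scalerDr -scalerAl !scalerA mulrC.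
Qed.
HB.instance Definition _ u :=
  GRing.isLinear.Build K E E *:%R (theta u) (theta_linear u).

Lemma theta_homog u g x : homog g x -> theta u x = u g *: x.
Proof.
case=> b bB ->; rewrite /theta (bigD1 g) //= big1 ?addr0 => [|h hg].
  by rewrite pr_homog // eqxx vsprojK.
by rewrite pr_homog // (negPf hg) linear0 mul0r scaler0.
Qed.

Lemma thetaB b : b \in B -> theta xi b = b.
Proof. by move/homogB/theta_homog->; rewrite (proj1 dxi) scale1r. Qed.

Lemma theta_monoid : monoid_morphism (theta xi).
Proof.
split=> [|x y]; first by rewrite thetaB ?B1.
rewrite [x]pr_sum [y]pr_sum !linear_sum !mulr_suml linear_sum.
apply: eq_bigr => g _; rewrite !mulr_sumr linear_sum; apply: eq_bigr => h _ /=.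
rewrite (theta_homog _ (homogM (homog_pr g x) (homog_pr h y))).
rewrite !(theta_homog _ (homog_pr _ _)) (proj2 dxi).
by rewrite -scalerAl -scalerAr scalerA.
Qed.

Lemma theta_comp u u' : (forall g, u g * u' g = 1) ->
  cancel (theta u') (theta u).
Proof.
move=> uu' x; rewrite [RHS]pr_sum {1}[x]pr_sum (linear_sum (theta u'))
  linear_sum.
apply: eq_bigr => g _ /=; rewrite (theta_homog _ (homog_pr g x)) linearZ /=.
by rewrite (theta_homog _ (homog_pr g x)) scalerA mulrC uu' scale1r.
Qed.

Lemma twist_charE (chi : E -> K) : scalar chi ->
  twist_char B a xi chi = chi \o theta xi.
Proof.
move=> chi_lin; apply: xget_unique => [|chi' [chi'_lin chi'E]].
  split=> [k x y|b g] /=; first by rewrite linearP chi_lin.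
  rewrite (theta_homog _ (homogBa g (subvsP b))).
  by rewrite (scalar_funZ chi_lin) mulrC.
apply/funext; apply: homog_ext_scalar => // [k x y|g x [b bB ->]] /=.
  by rewrite linearP chi_lin.
rewrite -(vsprojK bB) chi'E (theta_homog _ (homogBa g (subvsP _))).
by rewrite (scalar_funZ chi_lin) mulrC.
Qed.

End Twist.
End CrossedProduct.

(** * Linked characters and orbits *)

Section Links.
Variables (K : fieldType) (E : falgType K) (B : {aspace E}).
Variables (gT : finGroupType) (a : gT -> E) (t : {scalar E}).
Hypothesis cp : crossed_product B a t.
Hypotheses (ssE : semisimple E) (spE : split_algebra E).
Hypotheses (ssB : semisimple (subvs_of B)) (spB : split_algebra (subvs_of B)).
Hypothesis dual_separates :
  forall g : gT, g != 1%g -> exists2 xi, dual_group gT K xi & xi g != 1.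

Implicit Types (chi : E -> K) (psi : subvs_of B -> K) (xi : gT -> K) (g : gT).

Let aU := cp_unit cp.
Local Notation conjBV := (@conjBV K E B gT a).
Local Notation theta := (theta cp).
Local Notation IrrB := (Irr (subvs_of B)).
Local Notation IrrE := (Irr E).

(** The orbit of psi under G. *)
Definition orbG psi : set (subvs_of B -> K) :=
  [set conj_char a g psi | g in [set: gT]]%classic.
(** The orbit of chi under the dual group. *)
Definition orbD chi : set (E -> K) :=
  [set twist_char B a xi chi | xi in dual_group gT K]%classic.

Lemma orbGP psi psi' : IrrB psi ->
  orbG psi psi' <-> exists g, psi' = psi \o conjBV g.
Proof.
move=> Ipsi; split=> [[g _ <-]|[g ->]].
  by exists g; rewrite (conj_charE cp ssB spB).
by exists g => //; rewrite (conj_charE cp ssB spB).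
Qed.

Lemma Irr_scalar chi : IrrE chi -> scalar chi.
Proof.
by move=> [n [rho [_ rchi]]] k x y; rewrite !rchi !linearP.
Qed.

Lemma orbDP chi chi' : IrrE chi ->
  orbD chi chi' <-> exists2 xi, dual_group gT K xi & chi' = chi \o theta xi.
Proof.
move=> Ichi; split=> [[xi dxi <-]|[xi dxi ->]].
  by exists xi => //; rewrite (twist_charE cp) //; apply: Irr_scalar.
by exists xi; rewrite ?(twist_charE cp) //; apply: Irr_scalar.
Qed.

Definition dualV xi g := xi (g^-1)%g.

Lemma dualVP xi : dual_group gT K xi -> dual_group gT K (dualV xi).
Proof.
move=> [x1 xM]; split=> [|g h]; rewrite /dualV ?invg1 //.
by rewrite invMg xM mulrC.
Qed.

Lemma mul_dualV xi : dual_group gT K xi -> forall g, xi g * dualV xi g = 1.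
Proof. by move=> [x1 xM] g; rewrite -xM mulgV x1. Qed.

Lemma thetaK xi : dual_group gT K xi -> cancel (theta xi) (theta (dualV xi)).
Proof.
by move=> dxi; apply: theta_comp => g; rewrite mulrC mul_dualV.
Qed.

Lemma thetaVK xi : dual_group gT K xi -> cancel (theta (dualV xi)) (theta xi).
Proof. by move=> dxi; apply: theta_comp => g; apply: mul_dualV. Qed.

Lemma Irr_theta xi chi : dual_group gT K xi -> IrrE chi ->
  IrrE (chi \o theta xi).
Proof.
move=> dxi; apply: (Irr_precomp (theta_linear cp xi) (theta_monoid cp dxi)).
exact: thetaVK.
Qed.

Lemma idem_theta xi chi : dual_group gT K xi -> IrrE chi ->
  theta xi (idem (chi \o theta xi)) = idem chi.
Proof.
move=> dxi; apply: (idem_precomp ssE spE (theta_linear cp xi)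
  (theta_monoid cp dxi)
  (theta_linear cp (dualV xi)) (theta_monoid cp (dualVP dxi))).
  exact: thetaK.
exact: thetaVK.
Qed.

Lemma thetaM xi x y : dual_group gT K xi ->
  theta xi (x * y) = theta xi x * theta xi y.
Proof. by move=> dxi; have [_ ->] := theta_monoid cp dxi. Qed.

(** The component of degree g is multiplied by xi g, which differs from 1 for
    some xi when g != 1. *)
Lemma theta_fixed x :
  (forall xi, dual_group gT K xi -> theta xi x = x) -> x \in B.
Proof.
move=> fx; rewrite [x](pr_sum cp) rpred_sum // => g _.
have [->|g1] := eqVneq g 1%g; first by rewrite (cp_a1 cp) mulr1 subvsP.
have [xi dxi xg] := dual_separates g1.
suff -> : pr cp g x = 0 by rewrite linear0 mul0r mem0v.
have := congr1 (pr cp g) (fx _ dxi); rewrite /theta linear_sum.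
rewrite (bigD1 g) //= big1 ?addr0 => [|h hg]; last first.
  by rewrite linearZ /= (pr_homog0 cp (homog_pr cp h x)) ?scaler0 // eq_sym.
rewrite linearZ /= pr_homog ?subvsP // eqxx vsvalK => /eqP.
rewrite -subr_eq0 -[X in _ - X]scale1r -scalerBl scaler_eq0 subr_eq0.
by rewrite (negPf xg) => /eqP.
Qed.

Definition link psi chi := idem chi * vsval (idem psi) != 0.

Lemma link_conjBV g psi chi : IrrB psi -> IrrE chi ->
  link psi chi -> link (psi \o conjBV g) chi.
Proof.
move=> Ipsi Ichi; apply: contraNN => /eqP.
rewrite (idem_conjBV cp ssB spB) // (vsval_conjB cp) => e0.
have := congr1 (fun x => (a g)^-1 * x * a g) e0.
rewrite mulr0 mul0r !mulrA -(idem_central ssE spE (a g)^-1) // => e1.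
by rewrite -e1 -!mulrA mulKr ?aU // mulVr ?aU // mulr1.
Qed.

Lemma link_theta xi psi chi : dual_group gT K xi -> IrrE chi ->
  link psi chi -> link psi (chi \o theta xi).
Proof.
move=> dxi Ichi; apply: contraNN => /eqP e0.
have := congr1 (theta xi) e0; rewrite thetaM // idem_theta // linear0.
by rewrite thetaB ?subvsP // => ->.
Qed.

Lemma link_total_l psi : IrrB psi -> exists2 chi, IrrE chi & link psi chi.
Proof.
move=> Ipsi; apply: contrapT => nolink.
case/eqP: (idem_neq0 ssB spB Ipsi); apply: val_inj; rewrite /=.
rewrite -[vsval _]mul1r -(idem_sum_all ssE spE) mulr_suml big_seq big1 // =>
  chi.
rewrite (mem_Irr ssE spE) => /set_mem Ichi; apply/eqP/negPn/negP => l.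
by apply: nolink; exists chi.
Qed.

Lemma vsval_sum I (r : seq I) (P : pred I) (F : I -> subvs_of B) :
  vsval (\sum_(i <- r | P i) F i) = \sum_(i <- r | P i) vsval (F i).
Proof. exact: (linear_sum (@vsval K E B)). Qed.

Lemma link_total_r chi : IrrE chi -> exists2 psi, IrrB psi & link psi chi.
Proof.
move=> Ichi; apply: contrapT => nolink.
case/eqP: (idem_neq0 ssE spE Ichi).
rewrite -[LHS]mulr1 -(vsval1 cp) -(idem_sum_all ssB spB) vsval_sum.
rewrite mulr_sumr big_seq big1 // => psi.
rewrite (mem_Irr ssB spB) => /set_mem Ipsi; apply/eqP/negPn/negP => l.
by apply: nolink; exists psi.
Qed.

Lemma orbD_Irr chi : IrrE chi -> (orbD chi `<=` IrrE)%classic.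
Proof.
by move=> Ichi chi' /orbDP[//|xi dxi ->]; apply: Irr_theta.
Qed.

Lemma orbG_Irr psi : IrrB psi -> (orbG psi `<=` IrrB)%classic.
Proof.
by move=> Ipsi psi' /orbGP[//|g ->]; apply: (Irr_conjBV cp).
Qed.

Lemma orbD_refl chi : IrrE chi -> orbD chi chi.
Proof.
move=> Ichi; apply/orbDP => //; exists (fun=> 1).
  by split=> // g h; rewrite mulr1.
apply/funext => x /=; congr (chi _); rewrite [LHS](pr_sum cp).
by apply: eq_bigr => g _; rewrite scale1r.
Qed.

Lemma orbG_refl psi : IrrB psi -> orbG psi psi.
Proof.
move=> Ipsi; apply/orbGP => //; exists 1%g.
apply/funext => x /=; congr (psi _); apply: val_inj.
by rewrite /= (vsval_conjBV cp) (cp_a1 cp) invr1 mul1r mulr1.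
Qed.

Lemma orbD_theta chi chi' xi : IrrE chi -> dual_group gT K xi ->
  orbD chi chi' -> orbD chi (chi' \o theta xi).
Proof.
move=> Ichi dxi /orbDP[//|xi' dxi' ->]; apply/orbDP => //.
exists (fun g => xi' g * xi g).
  split=> [|g h]; first by rewrite (proj1 dxi) (proj1 dxi') mulr1.
  by rewrite (proj2 dxi) (proj2 dxi') mulrACA.
apply/funext => x /=; congr (chi _); rewrite [x](pr_sum cp).
rewrite (linear_sum (theta xi)) !linear_sum; apply: eq_bigr => g _ /=.
by rewrite !(theta_homog cp _ (homog_pr cp g x)) linearZ /=
  (theta_homog cp _ (homog_pr cp g x)) scalerA mulrC.
Qed.

(** The product a_h a_g differs from a_(hg) by a unit of B, which commutes with
    the central idempotents of B; this makes conjugation a group action on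
    characters. *)
Lemma idem_conjBV_cocycle g h psi : IrrB psi ->
  idem ((psi \o conjBV g) \o conjBV h) = idem (psi \o conjBV (h * g)%g).
Proof.
move=> Ipsi; have Ig := Irr_conjBV cp g Ipsi.
pose u := vsproj B (a h * a g * (a (h * g)%g)^-1).
have uE : vsval u = a h * a g * (a (h * g)%g)^-1.
  by rewrite vsprojK // (cp_cocycle cp).
have hgE : a h * a g = vsval u * a (h * g)%g by rewrite uE mulrVK ?aU.
set f := idem (psi \o conjBV (h * g)%g).
have fE : vsval f = a (h * g)%g * vsval (idem psi) * (a (h * g)%g)^-1.
  by rewrite /f (idem_conjBV cp ssB spB) // (vsval_conjB cp).
have fu : vsval f * vsval u = vsval u * vsval f.
  exact: (congr1 vsval (idem_central ssB spB u (Irr_conjBV cp (h * g)%g Ipsi))).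
rewrite !(idem_conjBV cp ssB spB) //; apply: val_inj => /=;
  rewrite !(vsval_conjB cp).
apply: (mulIr (aU h)); apply: (mulIr (aU g)).
rewrite mulrVK ?aU // -!mulrA mulVr ?aU // mulr1 mulrA hgE.
by rewrite [RHS]mulrA fu -[RHS]mulrA fE mulrVK ?aU // mulrA.
Qed.

Lemma comp_conjBV_cocycle g h psi : IrrB psi ->
  (psi \o conjBV g) \o conjBV h = psi \o conjBV (h * g)%g.
Proof.
move=> Ipsi; apply: (idem_inj ssB spB); rewrite ?idem_conjBV_cocycle //.
  by do 2!apply: (Irr_conjBV cp).
exact: (Irr_conjBV cp).
Qed.

Lemma orbG_conjBV psi psi' g : IrrB psi -> orbG psi psi' ->
  orbG psi (psi' \o conjBV g).
Proof.
move=> Ipsi /orbGP[//|h ->]; apply/orbGP => //.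
by exists (g * h)%g; rewrite comp_conjBV_cocycle.
Qed.

Lemma orbD_finite chi : IrrE chi -> finite_set (orbD chi).
Proof. by move/orbD_Irr/sub_finite_set; apply; apply: Irr_finite. Qed.

Lemma orbG_finite psi : IrrB psi -> finite_set (orbG psi).
Proof. by move/orbG_Irr/sub_finite_set; apply; apply: Irr_finite. Qed.

Lemma orbD_sum_theta (M : nmodType) (F : (E -> K) -> M) chi xi :
    IrrE chi -> dual_group gT K xi ->
  \sum_(chi' <- fset_set (orbD chi)) F (chi' \o theta xi) =
  \sum_(chi' <- fset_set (orbD chi)) F chi'.
Proof.
move=> Ichi dxi; have fin := orbD_finite Ichi.
apply: (big_fset_reindex (h := fun chi' => chi' \o theta xi)) =>
  [chi'|c1 c2 _ _ e12].
  by rewrite !in_fset_set // !inE; apply: orbD_theta.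
apply/funext => x; have := congr1 (fun c => c (theta (dualV xi) x)) e12.
by rewrite /= !thetaVK.
Qed.

Lemma orbG_sum_conjBV (M : nmodType) (F : (subvs_of B -> K) -> M) psi g :
    IrrB psi ->
  \sum_(psi' <- fset_set (orbG psi)) F (psi' \o conjBV g) =
  \sum_(psi' <- fset_set (orbG psi)) F psi'.
Proof.
move=> Ipsi; have fin := orbG_finite Ipsi.
apply: (big_fset_reindex (h := fun psi' => psi' \o conjBV g)) =>
  [psi'|c1 c2 _ _ e12].
  by rewrite !in_fset_set // !inE; apply: orbG_conjBV.
apply/funext => x; have := congr1 (fun c => c (conjB a g x)) e12.
by rewrite /= !(conjBK cp).
Qed.

Definition orbD_idem chi := \sum_(chi' <- fset_set (orbD chi)) idem chi'.
Definition orbG_idem psi := \sum_(psi' <- fset_set (orbG psi)) idem psi'.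

Lemma mem_orbD chi chi' : IrrE chi ->
  (chi' \in fset_set (orbD chi)) = `[< orbD chi chi' >].
Proof. by move=> Ichi; rewrite in_fset_set //; apply: orbD_finite. Qed.

Lemma mem_orbG psi psi' : IrrB psi ->
  (psi' \in fset_set (orbG psi)) = `[< orbG psi psi' >].
Proof. by move=> Ipsi; rewrite in_fset_set //; apply: orbG_finite. Qed.

Lemma orbD_idem_central chi : IrrE chi -> central_idempotent (orbD_idem chi).
Proof.
move=> Ichi; apply: (sum_idem_central_idempotent ssE spE) => chi'.
by rewrite mem_orbD // => /asboolP/orbD_Irr; apply.
Qed.

Lemma orbG_idem_central psi : IrrB psi -> central_idempotent (orbG_idem psi).
Proof.
move=> Ipsi; apply: (sum_idem_central_idempotent ssB spB) => psi'.
by rewrite mem_orbG // => /asboolP/orbG_Irr; apply.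
Qed.

Lemma idem_mul_orbD chi chi' : IrrE chi -> orbD chi chi' ->
  idem chi' * orbD_idem chi = idem chi'.
Proof.
move=> Ichi o; have Ichi' := orbD_Irr Ichi o.
rewrite mulr_sumr (big_fset_only (x := chi')) ?idem_idem // => [|c].
  by rewrite mem_orbD //; apply/asboolP.
rewrite mem_orbD // => /asboolP/(orbD_Irr Ichi) Ic neq.
by rewrite idem_orth // => /esym.
Qed.

Lemma idem_mul_orbG psi psi' : IrrB psi -> orbG psi psi' ->
  idem psi' * orbG_idem psi = idem psi'.
Proof.
move=> Ipsi o; have Ipsi' := orbG_Irr Ipsi o.
rewrite mulr_sumr (big_fset_only (x := psi')) ?idem_idem // => [|c].
  by rewrite mem_orbG //; apply/asboolP.
rewrite mem_orbG // => /asboolP/(orbG_Irr Ipsi) Ic neq.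
by rewrite idem_orth // => /esym.
Qed.

Lemma orbD_idem_neq0 chi chi' : IrrE chi -> IrrE chi' ->
  idem chi' * orbD_idem chi != 0 -> orbD chi chi'.
Proof.
move=> Ichi Ichi'; apply: contraNP => no;
  rewrite mulr_sumr big_seq big1 // => c.
rewrite mem_orbD // => /asboolP oc.
by rewrite idem_orth //; [apply: orbD_Irr oc | move=> e; case: no; rewrite e].
Qed.

Lemma orbG_idem_neq0 psi psi' : IrrB psi -> IrrB psi' ->
  idem psi' * orbG_idem psi != 0 -> orbG psi psi'.
Proof.
move=> Ipsi Ipsi'; apply: contraNP => no;
  rewrite mulr_sumr big_seq big1 // => c.
rewrite mem_orbG // => /asboolP oc.
by rewrite idem_orth //; [apply: orbG_Irr oc | move=> e; case: no; rewrite e].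
Qed.

(** Each [theta] permutes the summands, so the sum is fixed and lies in B. *)
Lemma orbD_idem_mem chi : IrrE chi -> orbD_idem chi \in B.
Proof.
move=> Ichi; apply: theta_fixed => xi dxi.
rewrite /orbD_idem (linear_sum (theta xi)) /=.
rewrite -(orbD_sum_theta (fun c => theta xi (idem c)) Ichi dxi) !big_seq.
apply: eq_bigr => chi'; rewrite mem_orbD // => /asboolP/(orbD_Irr Ichi) Ichi'.
exact: idem_theta.
Qed.

(** The sum commutes with B, and conjugation by a_g permutes its summands. *)
Lemma orbG_idem_central_total psi : IrrB psi ->
  central_idempotent (vsval (orbG_idem psi)).
Proof.
move=> Ipsi; have [ce ee] := orbG_idem_central Ipsi.
split=> [x|]; last by rewrite -[LHS]/(vsval (_ * _)) ee.
rewrite [x](pr_sum cp) mulr_suml mulr_sumr; apply: eq_bigr => g _.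
rewrite mulrA -[vsval _ * vsval (pr _ _ _)]/(vsval (_ * _)) ce /= -!mulrA.
congr (_ * _); suff : conjB a g (orbG_idem psi) = orbG_idem psi.
  by move/(congr1 vsval); rewrite (vsval_conjB cp) => h;
    rewrite -{1}h mulrVK ?aU.
rewrite /orbG_idem -[RHS](orbG_sum_conjBV _ g Ipsi).
rewrite (linear_fun_sum (conjB_linear cp g)) !big_seq; apply: eq_bigr => psi'.
by rewrite mem_orbG // => /asboolP/(orbG_Irr Ipsi) Ip; rewrite (idem_conjBV cp).
Qed.

(** The idempotent f of the dual orbit of chi is central in B, so e(psi) f is 0
    or e(psi). It is not 0 because e(psi) f e(chi) = e(psi) e(chi), so e(psi)
    absorbs f, and any chi' linked to psi must have e(chi') f != 0. *)
Lemma link_orbD psi chi chi' : IrrB psi -> IrrE chi -> IrrE chi' ->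
  link psi chi -> link psi chi' <-> orbD chi chi'.
Proof.
move=> Ipsi Ichi Ichi' l; split=> [l'|/orbDP[//|xi dxi ->]]; last first.
  exact: link_theta.
have eB := orbD_idem_mem Ichi; have [ce ee] := orbD_idem_central Ichi.
pose f := vsproj B (orbD_idem chi).
have fE : vsval f = orbD_idem chi by rewrite vsprojK.
have cf : central_idempotent f.
  by split=> [x|]; apply: val_inj; rewrite /= ?fE ?ce ?ee.
have [pf|pf] := irr_mul_idem ssB spB Ipsi cf.
  case/eqP: l; rewrite -(idem_mul_orbD Ichi (orbD_refl Ichi)) -mulrA ce.
  by rewrite -fE -[_ * vsval f]/(vsval (_ * _)) pf linear0 mulr0.
apply: orbD_idem_neq0 => //; apply: contra l' => /eqP e0.
by rewrite /link -pf /= fE -ce mulrA e0 mul0r.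
Qed.

(** The same argument with the roles exchanged: the idempotent of the G-orbit
    of psi is central in E, so e(chi) absorbs it. *)
Lemma link_orbG psi psi' chi : IrrB psi -> IrrB psi' -> IrrE chi ->
  link psi chi -> link psi' chi <-> orbG psi psi'.
Proof.
move=> Ipsi Ipsi' Ichi l; split=> [l'|/orbGP[//|g ->]]; last exact: link_conjBV.
have [ce ee] := orbG_idem_central Ipsi.
have ce' := orbG_idem_central_total Ipsi.
have [pf|pf] := irr_mul_idem ssE spE Ichi ce'.
  case/eqP: l; rewrite -(idem_mul_orbG Ipsi (orbG_refl Ipsi)) -ce /=.
  by rewrite mulrA pf mul0r.
apply: orbG_idem_neq0 => //; apply: contra l' => /eqP e0.
rewrite /link -pf -mulrA -[vsval _ * _]/(vsval (orbG_idem psi * idem psi')).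
by rewrite ce e0 linear0 mulr0.
Qed.

(** Both sides have the same product with every e(chi'): e(chi') if chi' is in
    the dual orbit of chi and 0 otherwise. *)
Lemma orbit_idem_eq psi chi : IrrB psi -> IrrE chi -> link psi chi ->
  vsval (orbG_idem psi) = orbD_idem chi.
Proof.
move=> Ipsi Ichi l; have ce := orbG_idem_central_total Ipsi.
rewrite -[LHS]mul1r -[RHS]mul1r -(idem_sum_all ssE spE) !mulr_suml !big_seq.
apply: eq_bigr => c; rewrite (mem_Irr ssE spE) => /set_mem Ic.
have [oc|noc] := pselect (orbD chi c).
  rewrite idem_mul_orbD //; have [c0|//] := irr_mul_idem ssE spE Ic ce.
  have /(link_orbD Ipsi Ichi Ic l) := oc; case/eqP.
  rewrite -(idem_mul_orbG Ipsi (orbG_refl Ipsi)) -(proj1 (orbG_idem_central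
    Ipsi)).
  by rewrite /= mulrA c0 mul0r.
have -> : idem c * orbD_idem chi = 0.
  by apply: contra_notP noc => /eqP; apply: orbD_idem_neq0.
rewrite /orbG_idem vsval_sum mulr_sumr big_seq big1 // => psi'.
rewrite mem_orbG // => /asboolP o; have Ip' := orbG_Irr Ipsi o.
apply: contra_notP noc => /eqP lc; apply/(link_orbD Ip' Ichi Ic) => //.
exact/(link_orbG Ipsi Ip' Ichi l).
Qed.

End Links.

(** * Restriction is multiplicity free *)

(** Compare entries at a place where P is not zero. For an idempotent P this
    says that the centre of the corner algebra P 'M_n P is spanned by P. *)
Lemma corner_scalar (K : fieldType) n (P X : 'M[K]_n) : P != 0 ->
    P *m X = X -> X *m P = X ->
    (forall M, X *m (P *m M *m P) = P *m M *m P *m X) ->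
  exists c, X = c *: P.
Proof.
move=> P0 PX XP comm.
have [[k j] /= Pkj] : exists kj, P kj.1 kj.2 != 0.
  apply: contrapT => no; case/eqP: P0; apply/matrixP=> k j; rewrite mxE.
  by apply/eqP/negPn/negP => ?; apply: no; exists (k, j).
exists (X k j / P k j); apply/matrixP=> i l; rewrite mxE.
have := comm (delta_mx l k); rewrite !mulmxA XP -!mulmxA PX !mulmxA.
rewrite -(mul_delta_mx (0 : 'I_1)) !mulmxA -!colE -!mulmxA -!rowE.
move/matrixP/(_ i j); rewrite !mxE !big_ord1 !mxE => e.
by rewrite mulrAC [X k j * _]mulrC -e mulfK.
Qed.

Section Multiplicity.
Variables (K : fieldType) (E : falgType K) (B : {aspace E}).
Variables (gT : finGroupType) (a : gT -> E) (t : {scalar E}).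
Hypothesis cp : crossed_product B a t.
Hypotheses (ssE : semisimple E) (spE : split_algebra E).
Hypotheses (ssB : semisimple (subvs_of B)) (spB : split_algebra (subvs_of B)).

Let aU := cp_unit cp.
Local Notation conjBV := (@conjBV K E B gT a).
Local Notation conjB := (@conjB K E B gT a).
Local Notation IrrB := (Irr (subvs_of B)).
Local Notation IrrE := (Irr E).

Variable psi : subvs_of B -> K.
Hypothesis Ipsi : IrrB psi.
Let e := vsval (idem psi).

Let eB b : b \in B -> e * b = b * e.
Proof.
move=> bB; rewrite -(vsprojK bB).
exact: (congr1 vsval (idem_central ssB spB (vsproj B b) Ipsi)).
Qed.

Let ee : e * e = e.
Proof. exact: (congr1 vsval (idem_idem ssB spB Ipsi)). Qed.

Definition stab := finset (fun g => a g * e == e * a g).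

Lemma stabP g : reflect (a g * e = e * a g) (g \in stab).
Proof. by rewrite inE; apply: eqP. Qed.

Lemma a_mul g h : exists2 u, u \in B & u \is a GRing.unit /\
  a g * a h = u * a (g * h)%g.
Proof.
exists (a g * a h * (a (g * h)%g)^-1); first exact: (cp_cocycle cp).
by rewrite !unitrMl ?unitrV ?aU // mulrVK ?aU.
Qed.

Lemma stab_group : group_set stab.
Proof.
apply/group_setP; split=> [|g h /stabP cg /stabP ch]; apply/stabP.
  by rewrite (cp_a1 cp) mulr1 mul1r.
have [u uB [uU uE]] := a_mul g h; apply: (mulrI uU).
rewrite !mulrA -uE -(eB uB) -[RHS]mulrA -uE.
by rewrite -mulrA ch mulrA cg -mulrA.
Qed.

Canonical stab_groupType := Group stab_group.

Lemma conj_in_stab g : (psi \o conjBV g == psi) = (g \in stab).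
Proof.
apply/eqP/stabP => [/(congr1 (@idem _ _))|cg].
  rewrite (idem_conjBV cp ssB spB) // => /(congr1 vsval).
  by rewrite (vsval_conjB cp) -/e => {2}<-; rewrite mulrVK ?aU.
apply: (idem_inj ssB spB) => //; first exact: (Irr_conjBV cp).
rewrite (idem_conjBV cp ssB spB) //; apply: val_inj.
by rewrite /= (vsval_conjB cp) -/e cg mulrK ?aU.
Qed.

(** For g outside the stabiliser, e and a_g e a_g^-1 are idempotents of
    distinct characters, hence orthogonal. *)
Lemma corner_out g : g \notin stab -> e * a g * e = 0.
Proof.
rewrite -conj_in_stab => /eqP neq; have Ig := Irr_conjBV cp g Ipsi.
have e0 : e * (a g * e * (a g)^-1) = 0.
  rewrite -(vsval_conjB cp) -(idem_conjBV cp ssB spB) //.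
  exact: (congr1 vsval (idem_orth ssB spB Ipsi Ig (nesym neq))).
by apply: (can_inj (mulrVK (aU g))); rewrite mul0r -e0 !mulrA.
Qed.

Hypothesis cycG : cyclic [set: gT].

Variables (chi : E -> K) (n : nat) (rho : {lrmorphism E -> 'M[K]_n}).
Hypotheses (Ichi : IrrE chi) (irr : irreducible_repr rho).
Hypothesis rchi : affords rho chi.
Hypothesis lnk : link psi chi.

Let re0 : rho e != 0.
Proof.
have [_ _ ke] := idemP ssE spE irr rchi.
apply: contra lnk => /eqP/ke.
by rewrite /link (idem_central ssE spE) // => ->.
Qed.

(** Skolem-Noether for the automorphism of B e given by conjugation with a_h:
    it is conjugation by an element u, with inverse u'. *)
Lemma stab_intertwiner h : h \in stab -> exists u u' : subvs_of B,
  [/\ vsval u * vsval u' * e = e &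
      forall b, vsval u' * vsval (conjB h b) * e = vsval b * vsval u' * e].
Proof.
move=> hS; have [m [tau [irt tpsi te kt surj]]] := IrrP ssB spB Ipsi.
have kt' x y : tau x = tau y -> vsval x * e = vsval y * e.
  move=> xy; apply/eqP; rewrite -subr_eq0 -mulrBl.
  rewrite -[_ * e]/(vsval ((x - y) * idem psi)) kt ?linear0 //.
  by rewrite linearB /= xy subrr.
have [|tau' irt' tau'E] := precomp_repr irt (conjB_linear cp h)
  (conjB_monoid cp h).
  by move=> x; exists (conjBV h x); rewrite (conjBVK cp).
have conjBe : conjB h (idem psi) = idem psi.
  apply: val_inj; rewrite /= (vsval_conjB cp) -/e; move/stabP: hS => ->.
  by rewrite mulrK ?aU.
have ker_sub x : tau x = 0 -> tau' x = 0.
  move/kt => x0; rewrite -[tau' x]mulmx1 -te -conjBe.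
  by rewrite -[tau (conjB _ _)]/((tau \o conjB h) _) -tau'E -reprM x0 linear0.
have [T [T' [TT' T'T Tx]]] := irr_intertwiner irt irt' surj ker_sub.
have [u uE] := surj T; have [u' u'E] := surj T'.
exists u, u'; split=> [|b].
  rewrite -[RHS]mul1r -(vsval1 cp) -[vsval u * _]/(vsval (u * u')); apply: kt'.
  by rewrite reprM uE u'E repr1.
rewrite -[vsval u' * _]/(vsval (u' * _)) -[vsval b * _]/(vsval (b * u')).
apply: kt'; rewrite !reprM u'E -[RHS]mul1mx -T'T -mulmxA; congr (_ *m _).
by rewrite mulmxA Tx tau'E -mulmxA TT' mulmx1.
Qed.

(** The decisive step, where a generator h of the stabiliser is available. The
    element y = u' a_h e commutes with B and with a_h e = u y, so with the
    whole corner e E e, and acts on the image of e as a scalar; then all powers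
    of a_h e act there through B. *)
Lemma corner_image x : exists b : subvs_of B,
  rho (e * x * e) = rho (vsval b) *m rho e.
Proof.
have /cyclicP[h stabE] : cyclic stab by apply: cyclicS cycG;
  apply: finset.subsetT.
have hS : h \in stab by rewrite stabE cycle_id.
have he : a h * e = e * a h by apply/stabP.
have [u [u' [uu' u'E]]] := stab_intertwiner hS.
pose y := vsval u' * a h * e.
have yB b : b \in B -> y * b = b * y.
  move=> bB; rewrite /y -!mulrA eB // (mulrA (a h)).
  have -> : a h * b = vsval (conjB h (vsproj B b)) * a h.
    by rewrite (vsval_conjB cp) vsprojK // mulrVK ?aU.
  rewrite -!mulrA he (mulrA _ e) (mulrA (vsval u')) mulrA.
  by rewrite u'E vsprojK // -!mulrA.
have ye : y * e = y by rewrite /y -!mulrA ee.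
have ahe : a h * e = vsval u * y.
  by rewrite /y -!mulrA he !mulrA uu'.
clearbody y.
(* One more factor a_h costs one factor y. *)
have gen k : exists2 c, c \in B &
    a (h ^+ k.+1)%g * e = c * (y * (a (h ^+ k)%g * e)).
  have [v vB [vU vE]] := a_mul h (h ^+ k).
  have ce : a (h ^+ k)%g * e = e * a (h ^+ k)%g.
    by apply/stabP; rewrite stabE mem_cycle.
  exists (v^-1 * vsval u); first by rewrite memvM ?memvV ?subvsP.
  apply: (mulrI vU); rewrite expgS [LHS]mulrA -vE -[LHS]mulrA ce [LHS]mulrA.
  by rewrite ahe !mulrA divrr // mul1r -(mulrA _ y e) ye.
have comm_pow k : y * (a (h ^+ k)%g * e) = a (h ^+ k)%g * e * y.
  elim: k => [|k IHk].
    by rewrite expg0 (cp_a1 cp) mul1r yB ?subvsP.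
  have [c cB ->] := gen k.
  by rewrite mulrA yB // -!mulrA; congr (_ * (_ * _)); rewrite IHk -mulrA.
have homog_corner g b : b \in B ->
    e * (b * a g) * e = if g \in stab then b * (a g * e) else 0.
  move=> bB; case: ifP => [/stabP ge|/negbT/corner_out ge].
    by rewrite mulrA eB // -!mulrA ge (mulrA e) ee.
  by rewrite mulrA eB // -!mulrA (mulrA e) ge mulr0.
have corner_sum z : e * z * e = \sum_(g in stab) vsval (pr cp g z) * (a g * e).
  rewrite {1}[z](pr_sum cp) mulr_sumr mulr_suml [RHS]big_mkcond.
  by apply: eq_bigr => g _; rewrite homog_corner ?subvsP.
have comm z : y * (e * z * e) = e * z * e * y.
  rewrite corner_sum mulr_sumr mulr_suml; apply: eq_bigr => g.
  rewrite stabE => /cycleP[k ->].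
  by rewrite mulrA yB ?subvsP // -!mulrA comm_pow -!mulrA.
(* By density the corner e E e maps onto the corner of the matrix algebra. *)
have [c yc] : exists c, rho y = c *: rho e.
  apply: corner_scalar => // [||M]; rewrite -?reprM ?ye //.
    by rewrite -yB ?subvsP // ye.
  have [z <-] := irr_surjective irr (spE irr) M.
  by rewrite -!reprM comm.
have pow_image k : exists b : subvs_of B,
  rho (a (h ^+ k)%g * e) = rho (vsval b) *m rho e.
  elim: k => [|k [b bE]].
    by exists 1; rewrite expg0 (cp_a1 cp) (vsval1 cp) mul1r repr1 mul1mx.
  have [d dB ->] := gen k; exists (c *: (vsproj B d * b)).
  rewrite (reprM rho d) (reprM rho y) yc bE -!scalemxAl -!scalemxAr /= linearZ
    /=.
  rewrite vsprojK // reprM -!scalemxAl -!mulmxA; congr (_ *: (_ *m _)).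
  by rewrite mulmxA -reprM eB ?subvsP // -reprM -mulrA ee reprM.
have img g : g \in stab -> exists b : subvs_of B,
  rho (a g * e) = rho (vsval b) *m rho e.
  by rewrite stabE => /cycleP[k ->].
have /choice[f fE] g : exists b : subvs_of B, g \in stab ->
    rho (a g * e) = rho (vsval b) *m rho e.
  by case: (boolP (g \in stab)) => [/img[b bE]|_]; [exists b | exists 0].
exists (\sum_(g in stab) pr cp g x * f g).
rewrite corner_sum linear_sum vsval_sum linear_sum mulmx_suml.
by apply: eq_bigr => g gS; rewrite /= !reprM -reprM fE // mulmxA.
Qed.

(** By [corner_image] every B-stable subspace of the image of e in the module
    of chi is stable under e E e, so this image is a simple B-module, with
    e(psi) acting as 1. The matrices J and Q are its inclusion and the
    projection onto it. *)
Lemma link_component : exists d (sigma : {lrmorphism subvs_of B -> 'M[K]_d})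
    (J : 'M_(n, d)) (Q : 'M_(d, n)),
  [/\ irreducible_repr sigma, affords sigma psi, J *m Q = rho e, Q *m J = 1%:M &
      forall b, rho (vsval b) *m J = J *m sigma b].
Proof.
pose act (c : subvs_of B) (v : 'cV[K]_n) := rho (vsval c) *m v.
have linl v : linear (act^~ v).
  by move=> k c d; rewrite /act /= linearP mulmxDl scalemxAl.
have linr c : linear (act c) by move=> k v w; rewrite /act linearP.
have actM c d v : act (c * d) v = act c (act d v).
  by rewrite /act reprM mulmxA.
pose W := (linfun (mulmx (rho e) : 'cV[K]_n -> 'cV[K]_n) @: fullv)%VS.
have memW v : reflect (rho e *m v = v) (v \in W).
  apply: (iffP idP) => [/memv_imgP[w _ ->]|ve].
    by rewrite lfunE /= mulmxA -reprM ee.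
  by apply/memv_imgP; exists v; rewrite ?memvf // lfunE /= ve.
have act1 : {in W, forall v, act 1 v = v}.
  by move=> v _; rewrite /act (vsval1 cp) repr1 mul1mx.
have actW c v : v \in W -> act c v \in W.
  by move/memW => vW; apply/memW; rewrite /act mulmxA -reprM eB ?subvsP // reprM
    -mulmxA vW.
pose sigma := sub_repr linl linr actM act1 actW.
have irs : irreducible_repr sigma.
  apply: sub_repr_irr => [|U UW Ust].
    apply: contra re0 => /eqP W0; apply/eqP/eq_mulmx_cV => v.
    by apply/eqP; rewrite mul0mx -memv0 -W0; apply/memW;
      rewrite mulmxA -reprM ee.
  have [->|U0] := eqVneq U 0%VS; [by left | right].
  apply/eqP; rewrite eqEsubv UW; apply/subvP => v /memW vW.
  have wU := memv_pick U; set w := vpick U in wU.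
  have w0 : w != 0 by rewrite vpick0.
  have /memW wW := subvP UW _ wU.
  have [x xw] := irr_cyclic irr v w0.
  have [c cE] := corner_image x.
  rewrite -vW -xw -wW mulmxA -reprM mulmxA -reprM cE -mulmxA wW.
  exact: Ust.
have se : sigma (idem psi) = 1%:M.
  apply: eq_mulmx_cV => v; apply: (@sub_val_inj _ _ W).
  by rewrite sub_valM mul1mx; apply/memW/sub_val_mem.
have spsi := idem_affords ssB spB Ipsi irs se.
have [J JE] := hom_cV_mx (linfun (@sub_val K _ W)).
have {}JE v : J *m v = sub_val v by rewrite -JE lfunE.
have /choice[q qE] (j : 'I_n) : exists v,
  J *m v = rho e *m delta_mx j (0 : 'I_1).
  have [|v <-] := @sub_val_surj _ _ W (rho e *m delta_mx j 0).
    by apply/memW; rewrite mulmxA -reprM ee.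
  by exists v; rewrite JE.
pose Q : 'M_(\dim W, n) := \matrix_(i, j) q j i 0.
have JQ : J *m Q = rho e.
  apply/matrixP=> i j; have /matrixP/(_ i 0) := qE j; rewrite -colE !mxE => <-.
  by apply: eq_bigr => k _; rewrite [Q _ _]mxE.
have Jb c : rho (vsval c) *m J = J *m sigma c.
  by apply: eq_mulmx_cV => v; rewrite -!mulmxA !JE sub_valM.
have QJ : Q *m J = 1%:M.
  apply: eq_mulmx_cV => v; apply: (@sub_val_inj _ _ W).
  by rewrite -!JE mul1mx mulmxA mulmxA JQ -mulmxA JE; apply/memW/sub_val_mem.
by exists (\dim W), sigma, J, Q.
Qed.

(** The trace of e b is the trace of b on the image of e. *)
Lemma link_restriction b : chi (e * vsval b) = psi b.
Proof.
have [d [sigma [J [Q [_ spsi JQ QJ Jb]]]]] := link_component.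
rewrite rchi reprM -JQ -mulmxA mxtrace_mulC -mulmxA Jb mulmxA QJ mul1mx.
by rewrite -spsi.
Qed.

(** Right multiplication by J identifies E e(chi) e(psi) with the n by d
    matrices. *)
Lemma link_dim d : \dim (lideal (idem psi)) = (d * d)%N ->
  \dim (lideal (idem chi * e)) = (n * d)%N.
Proof.
have [d' [sigma [J [Q [irs spsi JQ QJ Jb]]]]] := link_component.
rewrite (dim_lideal_idem ssB spB irs spsi) !mulnn => /eqP.
rewrite eqn_exp2r // => /eqP <-{d}.
have [[[ce cE] _ _] re ke] := idemP ssE spE irr rchi.
pose f := idem chi * e.
have fE : f * f = f by rewrite /f mulrA -(mulrA _ e) -ce !mulrA cE -mulrA ee.
have J_lin : linear (fun x => rho x *m J).
  by move=> k x y; rewrite linearP mulmxDl scalemxAl.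
pose g : 'Hom(E, 'M_(n, d')) := linfun (mk_linear J_lin).
have gE x : g x = rho x *m J by rewrite lfunE.
have : (lideal f :&: lker g)%VS = 0%VS.
  apply/eqP; rewrite -subv0; apply/subvP=> x /memv_capP[/(lidealP _ fE) xf].
  rewrite memv_ker gE memv0 => /eqP xJ.
  by rewrite -xf /f ce mulrA ke // reprM -JQ mulmxA xJ mul0mx.
move/limg_dim_eq<-; rewrite -[RHS](dim_matrix K n d') -dimvf; congr (\dim _).
apply/eqP; rewrite eqEsubv subvf; apply/subvP=> M _.
have [x xE] := irr_surjective irr (spE irr) (M *m Q).
apply/memv_imgP; exists (x * f); first by apply/(lidealP _ fE);
  rewrite -mulrA fE.
rewrite gE /f !reprM re mul1mx -mulmxA -JQ -mulmxA QJ mulmx1 xE.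
by rewrite -mulmxA QJ mulmx1.
Qed.

End Multiplicity.

(** * Counting characters in linked orbits *)

Section Counting.
Variables (K : fieldType) (E : falgType K) (B : {aspace E}).
Variables (gT : finGroupType) (a : gT -> E) (t : {scalar E}).
Hypothesis cp : crossed_product B a t.
Hypotheses (ssE : semisimple E) (spE : split_algebra E).
Hypotheses (ssB : semisimple (subvs_of B)) (spB : split_algebra (subvs_of B)).
Hypothesis dual_separates :
  forall g : gT, g != 1%g -> exists2 xi, dual_group gT K xi & xi g != 1.
Hypothesis cycG : cyclic [set: gT].

Let aU := cp_unit cp.
Local Notation conjBV := (@conjBV K E B gT a).
Local Notation conjB := (@conjB K E B gT a).
Local Notation IrrB := (Irr (subvs_of B)).
Local Notation IrrE := (Irr E).
Local Notation orbG := (@orbG K E B gT a).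
Local Notation orbD := (@orbD K E B gT a).

Lemma dim_lideal_conjBV g psi d : IrrB psi ->
  \dim (lideal (idem psi)) = (d * d)%N ->
  \dim (lideal (idem (psi \o conjBV g))) = (d * d)%N.
Proof.
move=> Ipsi; have [m [tau [irt tpsi _ _ _]]] := IrrP ssB spB Ipsi.
have [|tau' irt' tau'E] := precomp_repr irt (conjBV_linear cp g)
  (conjBV_monoid cp g).
  by move=> x; exists (conjB g x); rewrite (conjBK cp).
rewrite (dim_lideal_idem ssB spB irt tpsi) => <-.
by apply: (dim_lideal_idem ssB spB irt') => x; rewrite tau'E -tpsi.
Qed.

(** Since a_g e = e_g a_g, where e_g is the conjugate of e by a_g, the left
    ideal E e is the direct sum of the B e_g a_g, and these all have the same
    dimension. *)
Lemma dim_lideal_extend psi d : IrrB psi ->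
  \dim (lideal (idem psi)) = (d * d)%N ->
  \dim (lideal (vsval (idem psi))) = (#|gT| * (d * d))%N.
Proof.
move=> Ipsi dimd; pose e := vsval (idem psi).
have ee : e * e = e by apply: (congr1 vsval (idem_idem ssB spB Ipsi)).
(* The conjugate of e(psi) by a_g. *)
pose eg g := idem (psi \o conjBV g).
have egE g : a g * e = vsval (eg g) * a g.
  by rewrite /eg (idem_conjBV cp ssB spB) // (vsval_conjB cp) mulrVK ?aU.
have egI g : eg g * eg g = eg g by apply: idem_idem => //;
  apply: (Irr_conjBV cp).
pose ins g : 'Hom(subvs_of B, E) := (amulr (a g) \o linfun vsval)%VF.
have insE g b : ins g b = vsval b * a g by rewrite comp_lfunE !lfunE.
pose V g := (ins g @: lideal (eg g))%VS.
have dimV g : \dim (V g) = (d * d)%N.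
  rewrite /V limg_dim_eq ?(dim_lideal_conjBV g Ipsi dimd) //.
  suff /eqP-> : lker (ins g) == 0%VS by rewrite capv0.
  apply/lker0P => b c; rewrite !insE => /(mulIr (aU g)); exact: val_inj.
have dirV : directv (\sum_g V g).
  apply/directv_sum_independent => us usV us0 h _.
  have /choice[c cE] g : exists b : subvs_of B, us g = vsval b * a g.
    by have /memv_imgP[b _ ->] := usV g isT; exists b; rewrite insE.
  rewrite cE (homog_independent cp (c := fun g => vsval (c g))) ?mul0r //.
    by move=> g; apply: subvsP.
  by rewrite -[RHS]us0; apply: eq_bigr => g _; rewrite cE.
have -> : lideal e = (\sum_g V g)%VS.
  apply/eqP; rewrite eqEsubv; apply/andP; split; apply/subvP => x.
    move/(lidealP _ ee) => <-; rewrite [x](pr_sum cp) mulr_suml.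
    apply: memv_suml => g _; rewrite -mulrA egE mulrA.
    apply: (subvP (sumv_sup g isT (subvv _))); apply/memv_imgP.
    exists (pr cp g x * eg g); last by rewrite insE.
    by apply/(lidealP _ (egI g)); rewrite -mulrA egI.
  case/memv_sumP=> us usV ->; apply: memv_suml => g _.
  have /memv_imgP[b /(lidealP _ (egI g)) bg ->] := usV g isT.
  by apply/(lidealP _ ee); rewrite insE -mulrA egE mulrA
    -[_ * vsval (eg g)]/(vsval (b * eg g)) bg.
move/directvP: dirV => /= ->.
by under eq_bigr do rewrite dimV; rewrite sum_nat_const.
Qed.

Variables (psi : subvs_of B -> K) (chi : E -> K).
Hypotheses (Ipsi : IrrB psi) (Ichi : IrrE chi) (lnk : link psi chi).

Lemma orbit_links psi' chi' : orbG psi psi' -> orbD chi chi' -> link psi' chi'.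
Proof.
move=> o o'; have Ip := orbG_Irr cp ssB spB Ipsi o.
have Ic := orbD_Irr cp Ichi o'.
have l := proj2 (link_orbG cp ssE spE ssB spB Ipsi Ip Ichi lnk) o.
exact: proj2 (link_orbD cp ssE spE ssB spB dual_separates Ip Ichi Ic l) o'.
Qed.

Lemma char_idem c x : IrrE c -> c (idem c * x) = c x.
Proof.
move=> Ic; have [n [rho [irr rc re _ _]]] := IrrP ssE spE Ic.
by rewrite !rc reprM re mul1mx.
Qed.

(** Expand 1 as the sum of all e(psi'): the linked ones contribute psi' b, the
    others are killed by e(chi'). *)
Lemma orbit_restriction chi' b : orbD chi chi' ->
  chi' (vsval b) = \sum_(psi' <- fset_set (orbG psi)) psi' b.
Proof.
move=> o; have Ic := orbD_Irr cp Ichi o.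
have [n [rho [irr rc _ _ _]]] := IrrP ssE spE Ic.
have sub : (fset_set (orbG psi) `<=` fset_set IrrB)%fset.
  apply/fsubsetP => c; rewrite (mem_orbG cp) // (mem_Irr ssB spB) =>
    /asboolP oc.
  exact/mem_set/(orbG_Irr cp ssB spB Ipsi).
transitivity (\sum_(psi' <- fset_set (orbG psi))
    chi' (vsval (idem psi') * vsval b)); last first.
  rewrite !big_seq; apply: eq_bigr => psi'; rewrite (mem_orbG cp) //.
  move/asboolP => o'; have Ip := orbG_Irr cp ssB spB Ipsi o'.
  exact: (link_restriction cp ssE spE ssB spB Ip cycG Ic irr rc (orbit_links o'
    o)).
rewrite (big_fset_incl _ sub) => [|psi'].
  rewrite -(scalar_fun_sum (Irr_scalar Ic)) -mulr_suml -vsval_sum.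
  by rewrite idem_sum_all // (vsval1 cp) mul1r.
rewrite (mem_Irr ssB spB) (mem_orbG cp) // => /set_mem Ip /asboolPn no.
rewrite -char_idem // mulrA.
suff -> : idem chi' * vsval (idem psi') = 0.
  by rewrite mul0r -[0](scale0r 1) (scalar_funZ (Irr_scalar Ic)) mul0r.
apply: contra_notP no => /eqP l.
have l0 : link psi chi' := orbit_links (orbG_refl cp ssB spB Ipsi) o.
exact/(link_orbG cp ssE spE ssB spB Ipsi Ip Ic l0).
Qed.

(** Let d be the degree of psi, the same along its orbit. Cutting E e(chi') by
    the e(psi') of the orbit gives deg chi' = |Obar| d, and cutting E e(psi) by
    the e(chi') gives #|G| d^2 = |Om| (|Obar| d) d. *)
Lemma orbit_count :
  (#|` fset_set (orbG psi)| * #|` fset_set (orbD chi)|)%N = #|[set: gT]%SET|.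
Proof.
have [d [tau [irt tpsi _ _ _]]] := IrrP ssB spB Ipsi.
have dimd := dim_lideal_idem ssB spB irt tpsi.
have d0 : (0 < d)%N by have [] := irt.
have Ip psi' : orbG psi psi' -> IrrB psi' by apply: (orbG_Irr cp ssB spB).
have Ic chi' : orbD chi chi' -> IrrE chi' by apply: (orbD_Irr cp).
pose eB (psi' : subvs_of B -> K) : E := vsval (idem psi').
have eBc chi' x : IrrE chi' -> idem chi' * x = x * idem chi'.
  by move=> I; apply: idem_central.
have eBI psi' : IrrB psi' -> eB psi' * eB psi' = eB psi'.
  by move=> I; apply: (congr1 vsval (idem_idem ssB spB I)).
have mixI chi' psi' : IrrE chi' -> IrrB psi' ->
    (idem chi' * eB psi') * (idem chi' * eB psi') = idem chi' * eB psi'.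
  move=> I I'; rewrite mulrA -(mulrA _ (eB _)) -eBc // !mulrA idem_idem //.
  by rewrite -mulrA eBI.
have dimE psi' : orbG psi psi' -> \dim (lideal (idem psi')) = (d * d)%N.
  by move/(orbGP cp ssB spB _ Ipsi) => [g ->]; apply: dim_lideal_conjBV.
pose nb := #|` fset_set (orbG psi)|; pose no := #|` fset_set (orbD chi)|.
(* Here nb d appears as the degree of chi'. *)
have dim_mix chi' : orbD chi chi' ->
    \dim (lideal (idem chi' * eB psi)) = ((nb * d) * d)%N.
  move=> o; have I := Ic _ o; have [n [rho [irr rc _ _ _]]] := IrrP ssE spE I.
  have dimn := dim_lideal_idem ssE spE irr rc.
  have mix psi' : orbG psi psi' ->
      \dim (lideal (idem chi' * eB psi')) = (n * d)%N.
    move=> o'; apply: (link_dim cp ssE spE ssB spB (Ip _ o') cycG I irr rc).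
      exact: orbit_links.
    exact: dimE.
  rewrite mix; last exact: (orbG_refl cp ssB spB).
  congr (_ * _)%N; have n0 : (0 < n)%N by have [] := irr.
  apply/eqP; rewrite -(eqn_pmul2l n0) -dimn.
  have -> : idem chi' = \sum_(psi' <- fset_set (orbG psi)) idem chi' * eB psi'.
    rewrite -mulr_sumr -vsval_sum.
    rewrite -[\sum_(psi' <- _) idem psi']/(orbG_idem a psi).
    rewrite (orbit_idem_eq cp ssE spE ssB spB dual_separates Ipsi Ichi lnk).
    by rewrite (idem_mul_orbD cp ssE spE Ichi o).
  rewrite dim_lideal_sum ?fset_uniq //.
  - rewrite big_seq (eq_bigr (fun=> (n * d)%N)) => [|psi'].
      by rewrite -big_seq big_const_seq count_predT iter_addn_0 mulnC mulnCA
        mulnA.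
    by rewrite (mem_orbG cp) // => /asboolP /mix.
  - by move=> psi'; rewrite (mem_orbG cp) // => /asboolP/Ip Ip'; apply: mixI.
  move=> p1 p2; rewrite !(mem_orbG cp) // =>
    /asboolP/Ip I1 /asboolP/Ip I2 /eqP ne.
  rewrite mulrA -(mulrA _ (eB _)) -eBc // -!mulrA.
  rewrite -[eB p1 * _]/(vsval (idem p1 * idem p2)) idem_orth //.
  by rewrite linear0 !mulr0.
have := dim_lideal_extend Ipsi dimd.
have -> : vsval (idem psi) =
    \sum_(chi' <- fset_set (orbD chi)) idem chi' * eB psi.
  rewrite -mulr_suml -[\sum_(chi' <- _) _]/(orbD_idem B a chi).
  rewrite -(orbit_idem_eq cp ssE spE ssB spB dual_separates Ipsi Ichi lnk).
  rewrite -[RHS]/(vsval (orbG_idem a psi * idem psi)).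
  rewrite (proj1 (orbG_idem_central cp ssB spB Ipsi)).
  by rewrite (idem_mul_orbG cp ssB spB Ipsi) //; apply: (orbG_refl cp ssB spB).
rewrite dim_lideal_sum ?fset_uniq //.
- rewrite big_seq (eq_bigr (fun=> (nb * d * d)%N)) => [|chi']; last first.
    by rewrite (mem_orbD cp) // => /asboolP/dim_mix.
  rewrite -big_seq big_const_seq count_predT iter_addn_0.
  rewrite -/no mulnAC (mulnAC nb d) -mulnA => /eqP;
    rewrite eqn_pmul2r ?muln_gt0 ?d0 // cardsT => /eqP <-.
  by [].
- by move=> c; rewrite (mem_orbD cp) // => /asboolP/Ic Ic'; apply: mixI.
move=> p1 p2; rewrite !(mem_orbD cp) // =>
  /asboolP/Ic I1 /asboolP/Ic I2 /eqP ne.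
rewrite mulrA -(mulrA _ (eB _)) -eBc // !mulrA idem_orth //.
by rewrite !mul0r.
Qed.

End Counting.

(** * The character of an induced module *)

Section Induction.
Variables (K : fieldType) (E : falgType K) (B : {aspace E}).
Variables (gT : finGroupType) (a : gT -> E) (t : {scalar E}).
Hypothesis cp : crossed_product B a t.

Let aU := cp_unit cp.
Local Notation pr1 := (pr cp 1%g).

Lemma pr1_mulr z c : pr1 (z * vsval c) = pr1 z * c.
Proof.
rewrite [z](pr_sum cp) mulr_suml !linear_sum mulr_suml.
apply: eq_bigr => g _ /=.
have [->|g1] := eqVneq g 1%g.
  rewrite (cp_a1 cp) mulr1 (pr1B cp (subvsP (pr1 z))) vsvalK.
  have := pr1B cp (subvsP (pr1 z * c)); rewrite vsvalK => <-.
  by congr (pr1 _).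
rewrite [in RHS](pr_homog0 cp (homog_pr cp g z)) ?mul0r; last first.
  by rewrite eq_sym.
apply: (pr_homog0 cp (g := g)); last by rewrite eq_sym.
by have := homogM cp (homog_pr cp g z) (homogB cp (subvsP c)); rewrite mulg1.
Qed.

Lemma pr1_coset g h : pr1 ((a g)^-1 * a h) = (g == h)%:R.
Proof.
have hom : homog B a (g^-1 * h)%g ((a g)^-1 * a h).
  by apply: (homogM cp); [apply: (homogV cp) | apply: (homoga cp)].
case: eqP => [<-|neq].
  rewrite mulVr ?aU // (pr1B cp) ?(cp_one cp) //.
  by rewrite -(vsval1 cp) vsvalK.
apply: (pr_homog0 cp hom); apply/eqP => e1; apply: neq.
by rewrite -[h](mulKVg g) -e1 mulg1.
Qed.

(** The a_g form a basis of E as a right B-module; this expands z in it. *)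
Lemma coset_sum z : \sum_g a g * vsval (pr1 ((a g)^-1 * z)) = z.
Proof.
pose f := fun z => \sum_g a g * vsval (pr1 ((a g)^-1 * z)).
have f_lin : linear f.
  move=> k x y; rewrite /f scaler_sumr -big_split; apply: eq_bigr => g _ /=.
  by rewrite mulrDr -scalerAr linearP /= mulrDr scalerAr.
rewrite -[LHS]/(f z) [RHS](pr_sum cp) {1}[z](pr_sum cp) (linear_fun_sum f_lin).
apply: eq_bigr => g _.
set x := _ * a g.
have [b xb] : exists b : subvs_of B, x = a g * vsval b.
  exists (conjBV a g (pr cp g z)).
  by rewrite (vsval_conjBV cp) -mulrA mulVKr ?aU.
rewrite xb /f (bigD1 g) //= big1 ?addr0 => [|h hg].
  by rewrite mulrA pr1_mulr pr1_coset eqxx mul1r.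
by rewrite mulrA pr1_mulr pr1_coset (negPf hg) mul0r /= mulr0.
Qed.

Section Explicit.
Variables (n : nat) (rho : {lrmorphism subvs_of B -> 'M[K]_n}).
Local Notation m := (\sum_(i < #|gT|) n)%N.
Let ai (i : 'I_#|gT|) := a (enum_val i).

Let sum_ai (V : nmodType) (F : gT -> V) :
  \sum_(i < #|gT|) F (enum_val i) = \sum_g F g.
Proof. by rewrite -(big_enum_val F); apply: eq_bigl => g. Qed.

(** The action of x on the tensor product of E with the module of rho over B,
    in the basis of the elements a_g (x) v. The blocks all have size n and are
    indexed by G through its enumeration. *)
Definition ind_fun x : 'M[K]_m :=
  \mxblock_(i, j) rho (pr1 ((ai i)^-1 * x * ai j)).

Fact ind_linear : linear ind_fun.
Proof.
move=> k x y; apply/mxblockP => i j.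
rewrite submxblockD mxblockK.
have -> : submxblock (k *: ind_fun x) i j = k *: submxblock (ind_fun x) i j.
  by apply/matrixP => r s; rewrite !mxE.
rewrite !mxblockK mulrDr mulrDl -scalerAr -scalerAl.
by rewrite linearP linearP.
Qed.

Let coset_block (x z : E) i :
  \sum_(j < #|gT|) rho (pr1 ((ai i)^-1 * x * ai j)) *m rho (pr1 ((ai j)^-1 * z))
  = rho (pr1 ((ai i)^-1 * x * z)).
Proof.
rewrite -{2}[z]coset_sum -sum_ai mulr_sumr !linear_sum; apply: eq_bigr => j _.
by rewrite /= -reprM -pr1_mulr !mulrA.
Qed.

Fact ind_monoid : monoid_morphism ind_fun.
Proof.
split=> [|x y].
  rewrite -[RHS]/(1%:M) -mxdiagZ; apply/eq_mxblock => i j.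
  rewrite mulr1 pr1_coset (inj_eq enum_val_inj).
  case: eqVneq => [_|_]; last by rewrite linear0.
  by rewrite conform_mx_id repr1.
rewrite -[RHS]/(_ *m _) mul_mxblock; apply: eq_mxblock => i j.
under eq_bigr do rewrite -[(ai _)^-1 * y * _]mulrA.
by rewrite coset_block !mulrA.
Qed.

Definition ind_repr := mk_repr ind_linear ind_monoid.

Lemma ind_trace x :
  \tr (ind_repr x) = \sum_g \tr (rho (pr1 ((a g)^-1 * x * a g))).
Proof. by rewrite mxtrace_mxblock -sum_ai. Qed.

(** The universal property: u embeds the module of rho as the vectors 1 (x) v,
    and an intertwiner f extends uniquely by a_g (x) v |-> tau (a_g) f v. *)
Lemma ind_induced : is_induced rho ind_repr.
Proof.
pose u : 'M[K]_(m, n) := \mxcol_i rho (pr1 (ai i)^-1).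
have indu x : ind_repr x *m u = \mxcol_i rho (pr1 ((ai i)^-1 * x)).
  rewrite mul_mxblock_mxrow; apply: eq_mxcol => i.
  rewrite -[X in _ = rho (pr1 X)]mulr1 -coset_block; apply: eq_bigr => j _.
  by rewrite mulr1.
exists u; split=> [b|k tau f fE].
  rewrite indu mxcol_mul; apply: eq_mxcol => i.
  by rewrite pr1_mulr reprM.
pose h : 'M[K]_(k, m) := \mxrow_i (tau (ai i) *m f).
exists h; split=> [|h' [h'E h'u]]; last first.
  rewrite -[h']submxrowK; apply: eq_mxrow => j.
  rewrite -h'u mulmxA h'E -mulmxA indu -[X in X *m _]submxrowK mul_mxrow_mxcol.
  rewrite (bigD1 j) //= big1 => [|i ij].
    by rewrite pr1_coset eqxx repr1 mulmx1 addr0.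
  by rewrite pr1_coset (inj_eq enum_val_inj) (negPf ij) linear0 mulmx0.
have sum_tau z : \sum_(i < #|gT|) (tau (ai i) *m f) *m rho (pr1 ((ai i)^-1 * z))
    = tau z *m f.
  rewrite -{2}[z]coset_sum -sum_ai linear_sum mulmx_suml; apply: eq_bigr => i _.
  by rewrite /= reprM -mulmxA -fE mulmxA.
split=> [x|].
  rewrite mul_mxrow mul_mxrow_mxblock; apply: eq_mxrow => j.
  under eq_bigr do rewrite -[_^-1 * x * _]mulrA.
  by rewrite sum_tau mulmxA reprM.
rewrite mul_mxrow_mxcol.
rewrite -[RHS]mul1mx -(repr1 tau) -sum_tau; apply: eq_bigr => i _.
by rewrite mulr1.
Qed.

(** The universal property determines the induced representation up to
    isomorphism. *)
Lemma induced_trace k (sigma : {lrmorphism E -> 'M[K]_k}) x :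
  is_induced rho sigma -> \tr (sigma x) = \tr (ind_repr x).
Proof.
have [u [uE uU]] := ind_induced.
move=> [v [vE vU]].
have [h [[hE hu] _]] := uU _ _ _ vE.
have [h' [[h'E h'v] _]] := vU _ _ _ uE.
have [f [_ fU]] := uU _ _ _ uE.
have [f' [_ f'U]] := vU _ _ _ vE.
apply: (@trace_intertwined _ _ _ _ _ _ h h') => //.
  rewrite -(f'U (h *m h')) ?(f'U 1%:M) ?mul1mx //.
    by split=> // y; rewrite mulmx1 mul1mx.
  split=> [y|]; first by rewrite mulmxA hE -mulmxA h'E mulmxA.
  by rewrite -mulmxA h'v.
rewrite -(fU (h' *m h)) ?(fU 1%:M) ?mul1mx //.
  by split=> // y; rewrite mulmx1 mul1mx.
split=> [y|]; first by rewrite mulmxA h'E -mulmxA hE mulmxA.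
by rewrite -mulmxA hu.
Qed.

End Explicit.

(** The formula depends on the character psi only, so it does not matter which
    of the representations affording psi is induced; in positive characteristic
    they need not be isomorphic. *)
Lemma IndE psi x : Irr (subvs_of B) psi ->
  Ind psi x = \sum_g psi (pr1 ((a g)^-1 * x * a g)).
Proof.
move=> [n [rho [_ rpsi]]].
suff /(congr1 (fun f => f x)) /= : Ind psi =
  fun x => \sum_g psi (pr1 ((a g)^-1 * x * a g)) by [].
apply: xget_unique => [|c [n' [rho' [k [sigma [rpsi' ind cE]]]]]].
  exists n, rho, _, (ind_repr rho); split=> // [|y].
    exact: ind_induced.
  by rewrite ind_trace; apply: eq_bigr => g _.
apply/funext => y; rewrite cE (induced_trace y ind) ind_trace.
by apply: eq_bigr => g _; rewrite rpsi'.
Qed.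

End Induction.

(** * The correspondence for crossed products *)

Section Correspondence.
Variables (K : fieldType) (E : falgType K) (B : {aspace E}).
Variables (gT : finGroupType) (a : gT -> E) (t : {scalar E}).
Hypothesis cp : crossed_product B a t.
Hypotheses (ssE : semisimple E) (spE : split_algebra E).
Hypotheses (ssB : semisimple (subvs_of B)) (spB : split_algebra (subvs_of B)).
Hypothesis dual_separates :
  forall g : gT, g != 1%g -> exists2 xi, dual_group gT K xi & xi g != 1.
Hypothesis cycG : cyclic [set: gT].

Local Notation conjBV := (@conjBV K E B gT a).
Local Notation theta := (theta cp).
Local Notation IrrB := (Irr (subvs_of B)).
Local Notation IrrE := (Irr E).
Local Notation orbG := (@orbG K E B gT a).
Local Notation orbD := (@orbD K E B gT a).
Local Notation stab psi := (stab a psi).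

Section LinkedPair.
Variables (psi : subvs_of B -> K) (chi : E -> K).
Hypotheses (Ipsi : IrrB psi) (Ichi : IrrE chi) (lnk : link psi chi).

Lemma conjBV_eq g h :
  (psi \o conjBV g == psi \o conjBV h) = ((h^-1 * g)%g \in stab psi).
Proof.
rewrite -(conj_in_stab cp ssB spB Ipsi).
have psi1 : psi \o conjBV 1%g = psi.
  by apply/eqP; rewrite (conj_in_stab cp ssB spB Ipsi)
    (group1 (stab_groupType cp ssB spB Ipsi)).
have comp := comp_conjBV_cocycle cp ssB spB _ _ Ipsi.
apply/eqP/eqP => [e|e]; first by rewrite -comp e comp mulVg psi1.
by rewrite -[in RHS]e comp mulKVg.
Qed.

(** Orbit-stabiliser: the elements of G taking psi to a given conjugate form a
    coset of the stabiliser. *)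
Lemma sum_over_group (M : nmodType) (F : (subvs_of B -> K) -> M) :
  \sum_g F (psi \o conjBV g) =
  (\sum_(psi' <- fset_set (orbG psi)) F psi') *+ #|stab psi|.
Proof.
pose X := fset_set (orbG psi).
have memX g : psi \o conjBV g \in X.
  by rewrite (mem_orbG cp) //; apply/asboolP/(orbGP cp ssB spB _ Ipsi);
    exists g.
transitivity (\sum_g \sum_(psi' <- X)
    if psi \o conjBV g == psi' then F psi' else 0).
  apply: eq_bigr => g _; rewrite (big_fset_only (memX g)) ?eqxx // => y _ /eqP.
  by rewrite eq_sym => /negPf->.
rewrite exchange_big -sumrMnl !big_seq; apply: eq_bigr => psi'.
rewrite (mem_orbG cp) // => /asboolP /(orbGP cp ssB spB _ Ipsi)[h ->].
rewrite -big_mkcond sumr_const; congr (_ *+ _).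
rewrite -(card_lcoset (stab psi) h); apply: eq_card => g.
by rewrite mem_lcoset -conjBV_eq.
Qed.

Lemma card_stab : #|stab psi| = #|` fset_set (orbD chi)|.
Proof.
(* Take the constant 1, as an integer so that cardinals can be compared. *)
have := sum_over_group (fun=> 1%:Z); rewrite sumr_const.
rewrite big_const_seq count_predT iter_addr_0 -mulrnA => /eqP.
rewrite Num.Theory.eqr_nat => /eqP cG.
have X0 : (0 < #|` fset_set (orbG psi)|)%N.
  rewrite cardfs_gt0; apply/fset0Pn; exists psi; rewrite (mem_orbG cp) //.
  exact/asboolP/(orbG_refl cp ssB spB).
have := orbit_count cp ssE spE ssB spB dual_separates cycG Ipsi Ichi lnk.
rewrite cardsT cG => /eqP.
by rewrite eqn_pmul2l // => /eqP.
Qed.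

(** On B a_k with k != 1 the left side vanishes because conjugation preserves
    the degree k up to conjugacy, and the right side because it is invariant
    under twisting by some xi with xi k != 1. On B the left side counts each
    conjugate of psi as often as there are elements in the stabiliser, of which
    there are |Om|; the right side is |Om| times the common restriction. *)
Lemma orbit_induction x : Ind psi x = \sum_(chi' <- fset_set (orbD chi)) chi' x.
Proof.
rewrite (IndE cp _ Ipsi).
have psi_lin := Irr_scalar Ipsi.
have IX chi' : chi' \in fset_set (orbD chi) -> IrrE chi'.
  by rewrite (mem_orbD cp) // => /asboolP/(orbD_Irr cp Ichi).
pose l x := \sum_g psi (pr cp 1%g ((a g)^-1 * x * a g)).
pose r x := \sum_(chi' <- fset_set (orbD chi)) chi' x.
rewrite -/(l x) -/(r x); move: x; apply: (homog_ext_scalar cp).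
- move=> k x y; rewrite /l mulr_sumr -big_split; apply: eq_bigr => g _ /=.
  by rewrite mulrDr mulrDl -scalerAr -scalerAl linearP psi_lin.
- move=> k x y; rewrite /r mulr_sumr -big_split !big_seq;
  apply: eq_bigr => c /IX.
  by move/Irr_scalar => ->.
move=> k x hx; have [k1|k1] := eqVneq k 1%g.
  have xB : x \in B by apply: (homog1P cp); rewrite -k1.
  pose b := vsproj B x; have bx : vsval b = x by rewrite vsprojK.
  have -> : l x = \sum_g (psi \o conjBV g) b.
    apply: eq_bigr => g _ /=; congr (psi _); apply: val_inj.
    have gxB := conj_inv_mem cp g xB.
    by rewrite /= (vsval_conjBV cp) bx (pr1B cp gxB) vsprojK.
  rewrite (sum_over_group (fun p => p b)) card_stab /r.
  rewrite [RHS](eq_big_seq (fun=> \sum_(p <- fset_set (orbG psi)) p b)).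
    by rewrite big_const_seq count_predT iter_addr_0.
  move=> c; rewrite (mem_orbD cp) // => /asboolP oc; rewrite -bx.
  exact: (orbit_restriction cp ssE spE ssB spB dual_separates cycG Ipsi Ichi
    lnk).
have -> : l x = 0.
  apply: big1 => g _; rewrite (pr_homog0 cp (g := (g^-1 * k * g)%g)).
  - by rewrite -[0](scale0r 0) (scalar_funZ psi_lin) mul0r.
  - by apply: (homogM cp); [apply: (homogM cp) => //;
    apply: (homogV cp) | apply: (homoga cp)].
  by rewrite eq_sym -mulgA -conjgE conjg_eq1.
have [xi dxi xk] := dual_separates k1.
have := orbD_sum_theta cp ssE spE (fun c : E -> K => c x) Ichi dxi;
  rewrite -/(r x) => rx.
have : r x = xi k * r x.
  rewrite -{1}rx mulr_sumr !big_seq; apply: eq_bigr => c /IX Ic.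
  by rewrite /= (theta_homog cp _ hx) (scalar_funZ (Irr_scalar Ic)).
move/eqP; rewrite -subr_eq0 -[X in X - _]mul1r -mulrBl mulf_eq0 subr_eq0.
by rewrite eq_sym (negPf xk) => /eqP->.
Qed.

Lemma trace_theta xi x : dual_group gT K xi -> t (theta xi x) = t x.
Proof.
move=> dxi; move: x; apply: (homog_ext_scalar cp) => [k x y|k x y|g x hx].
- by rewrite !linearP.
- by rewrite linearP.
rewrite (theta_homog cp _ hx) linearZ /=.
have [->|g1] := eqVneq g 1%g; first by rewrite (proj1 dxi) mul1r.
by rewrite (trace_homog cp g1 hx) mulr0.
Qed.

(** Let c be the multiplier of the form on the block of chi; it is the same for
    all chi' in the orbit, because the form is invariant under [theta]. Writing
    e(psi) b as the sum of the e(chi') e(psi) b shows that the multiplier on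
    the block of psi is |Om| c. In particular |Om| is invertible in K. *)
Lemma orbit_schur :
  schur_element t chi =
  (#|` fset_set (orbD chi)|)%:R * schur_element (Res t) psi.
Proof.
pose tB : {scalar subvs_of B} := t \o vsval.
have tBC x y : tB (x * y) = tB (y * x) by apply: (cp_traceC cp).
have tB_nondeg x : (forall y, tB (x * y) = 0) -> x = 0.
  move=> x0; apply: val_inj; apply: (cp_nondegB cp (subvsP x)) => y yB.
  by rewrite -(vsprojK yB); apply: x0.
have [c tc] := trace_form_block ssE spE (cp_traceC cp) Ichi.
have [cB tcB] := trace_form_block ssB spB tBC Ipsi.
have [c0 ->] := schur_elementE ssE spE (cp_nondeg cp) Ichi tc.
have [cB0 sB] := schur_elementE ssB spB tB_nondeg Ipsi tcB.
rewrite -[schur_element (Res t) psi]/(schur_element tB psi) sB.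
have tc' chi' x : orbD chi chi' -> t (idem chi' * x) = c * chi' x.
  move=> /(orbDP cp _ Ichi)[xi dxi ->]; rewrite -(trace_theta _ dxi).
  by rewrite (thetaM cp) // (idem_theta cp ssE spE dxi Ichi) tc.
have [n [tau [irt tpsi _ _ _]]] := IrrP ssB spB Ipsi.
have [b] := irr_char_neq0 spB irt; rewrite -tpsi => psib.
have : cB = (#|` fset_set (orbD chi)|)%:R * c.
  have := tcB b; rewrite psib mulr1 => <-; rewrite /tB /=.
  have -> : vsval (idem psi) * vsval b =
      \sum_(chi' <- fset_set (orbD chi)) idem chi' * (vsval (idem psi) * vsval
        b).
    rewrite -mulr_suml -[\sum_(_ <- _) _]/(orbD_idem B a chi) mulrA.
    rewrite -(orbit_idem_eq cp ssE spE ssB spB dual_separates Ipsi Ichi lnk).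
    rewrite -[_ * vsval (idem psi)]/(vsval (orbG_idem a psi * idem psi)).
    rewrite (proj1 (orbG_idem_central cp ssB spB Ipsi)).
    by rewrite (idem_mul_orbG cp ssB spB Ipsi (orbG_refl cp ssB spB Ipsi)).
  rewrite linear_sum (eq_big_seq (fun=> c)) => [|chi'].
    by rewrite big_const_seq count_predT iter_addr_0 mulr_natl.
  rewrite (mem_orbD cp) // => /asboolP o; rewrite /= (tc' _ _ o).
  have Ic := orbD_Irr cp Ichi o.
  have [m [rho [irr rc _ _ _]]] := IrrP ssE spE Ic.
  have l : link psi chi'.
    by apply: (proj2 (link_orbD cp ssE spE ssB spB dual_separates Ipsi Ichi Ic
      lnk)).
  rewrite (link_restriction cp ssE spE ssB spB Ipsi cycG Ic irr rc l).
  by rewrite psib mulr1.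
move=> cBE; move: cB0; rewrite cBE mulf_eq0 negb_or => /andP[n0 _].
by rewrite invfM mulrA divff // mul1r.
Qed.

Lemma orbG_links : orbG psi = [set p | IrrB p /\ link p chi]%classic.
Proof.
apply/seteqP; split=> [p o|p [Ip l]] /=.
  have Ip := orbG_Irr cp ssB spB Ipsi o; split=> //.
  exact: (proj2 (link_orbG cp ssE spE ssB spB Ipsi Ip Ichi lnk)).
exact: (proj1 (link_orbG cp ssE spE ssB spB Ipsi Ip Ichi lnk)).
Qed.

Lemma orbD_links : orbD chi = [set c | IrrE c /\ link psi c]%classic.
Proof.
apply/seteqP; split=> [c o|c [Ic l]] /=.
  have Ic := orbD_Irr cp Ichi o; split=> //.
  exact: (proj2 (link_orbD cp ssE spE ssB spB dual_separates Ipsi Ichi Ic lnk)).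
exact: (proj1 (link_orbD cp ssE spE ssB spB dual_separates Ipsi Ichi Ic lnk)).
Qed.

End LinkedPair.

(** The bijection of the theorem. *)
Definition linked_set (Obar : set (subvs_of B -> K)) : set (E -> K) :=
  [set chi | IrrE chi /\ exists2 psi, Obar psi & link psi chi]%classic.

Lemma linked_set_orbit psi chi : IrrB psi -> IrrE chi -> link psi chi ->
  linked_set (orbG psi) = orbD chi.
Proof.
move=> Ipsi Ichi l; rewrite (orbD_links Ipsi Ichi l) (orbG_links Ipsi Ichi l).
apply/seteqP; split=> [c [Ic [p [Ip lp] lc]]|c [Ic lc]]; split=> //; last first.
  by exists psi.
have : orbD chi c by rewrite (orbD_links Ip Ichi lp).
by rewrite (orbD_links Ipsi Ichi l) => -[].
Qed.

Theorem crossed_product_clifford :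
  exists f : set (subvs_of B -> K) -> set (E -> K),
    set_bij (orbits (conj_char a) setT IrrB)
      (orbits (twist_char B a) (dual_group gT K) IrrE) f /\
    forall Obar, orbits (conj_char a) setT IrrB Obar ->
      let Om := f Obar in
      [/\ vsval (idem_sum Obar) = idem_sum Om,
          (ncard Obar * ncard Om)%N = #|[set: gT]%SET|,
          forall chi, Om chi ->
            forall b, Res chi b = \sum_(psi \in Obar) psi b,
          forall psi, Obar psi ->
            forall x, Ind psi x = \sum_(chi \in Om) chi x &
          forall chi psi, Om chi -> Obar psi ->
            schur_element t chi =
            (ncard Om)%:R * schur_element (Res t) psi].
Proof.
have lr := link_total_l ssE spE ssB spB.
exists linked_set; split=> [|_ [psi Ipsi <-]]; last first.
  rewrite -/(orbG psi); have [chi Ichi l] := lr _ Ipsi.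
  rewrite (linked_set_orbit Ipsi Ichi l) /=.
  have finG := orbG_finite cp ssB spB Ipsi;
    have finD := orbD_finite cp ssE spE Ichi.
  have links p c := orbit_links cp ssE spE ssB spB dual_separates Ipsi Ichi l
    (psi' := p) (chi' := c).
  have IB p : orbG psi p -> IrrB p by apply: (orbG_Irr cp ssB spB).
  have IE c : orbD chi c -> IrrE c by apply: (orbD_Irr cp).
  have GG := orbG_refl cp ssB spB Ipsi; have DD := orbD_refl cp Ichi.
  have orbD_eq c : orbD chi c -> orbD c = orbD chi.
    move=> o; have lc := links _ _ GG o.
    by rewrite (orbD_links Ipsi (IE _ o) lc) (orbD_links Ipsi Ichi l).
  split.
  - rewrite /idem_sum !fsbig_finite //.
    exact: (orbit_idem_eq cp ssE spE ssB spB dual_separates Ipsi Ichi l).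
  - exact: (orbit_count cp ssE spE ssB spB dual_separates cycG Ipsi Ichi l).
  - move=> c o b; rewrite fsbig_finite //.
    exact: (orbit_restriction cp ssE spE ssB spB dual_separates cycG Ipsi Ichi
      l).
  - move=> p o x; rewrite fsbig_finite //.
    exact: (orbit_induction (IB _ o) Ichi (links _ _ o DD)).
  move=> c p oc op; rewrite /ncard -(orbD_eq c oc).
  exact: (orbit_schur (IB _ op) (IE _ oc) (links _ _ op oc)).
split.
- move=> _ [psi Ipsi <-]; have [chi Ichi l] := lr _ Ipsi.
  rewrite -/(orbG psi) (linked_set_orbit Ipsi Ichi l).
  by exists chi.
- move=> O1 O2 /set_mem[p1 I1 <-] /set_mem[p2 I2 <-]; rewrite -!/(orbG _).
  have [c1 J1 l1] := lr _ I1; have [c2 J2 l2] := lr _ I2.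
  rewrite (linked_set_orbit I1 J1 l1) (linked_set_orbit I2 J2 l2) => e12.
  have l21 : link p2 c1.
    have : orbD c2 c1 by rewrite -e12; apply: (orbD_refl cp).
    by rewrite (orbD_links I2 J2 l2) => -[].
  by rewrite (orbG_links I1 J1 l1) (orbG_links I2 J1 l21).
move=> _ [chi Ichi <-]; have [psi Ipsi l] := link_total_r cp ssE spE ssB spB
  Ichi.
by exists (orbG psi); [exists psi | apply: linked_set_orbit].
Qed.

End Correspondence.

(** * Linear characters of an abelian group *)

(** If every linear character took the value 1 at g, then g would act trivially
    on all simple submodules of the regular module, which are lines spanned by
    eigenvectors, hence on their sum, the faithful regular module itself. *)
Lemma abelian_dual_separates (K : fieldType) (gT : finGroupType) :
  abelian [set: gT]%SET -> group_algebra_split_semisimple gT K ->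
  forall g : gT, g != 1%g -> exists2 xi, dual_group gT K xi & xi g != 1.
Proof.
move=> abG [[redG] splitG] g g1; apply: contrapT => nosep.
pose rG := regular_repr K [set: gT].
have inG h : h \in [set: gT]%SET by rewrite finset.in_setT.
have simple_fixed U : mxsimple rG U -> (U <= kermx (rG g - 1%:M))%MS.
  move=> simU; have rU := mxsimple_abelian_linear splitG abG simU.
  have [modU U0 _] := simU.
  have [v [v0 vU Uv]] : exists v : 'rV_ _, [/\ v != 0,
    (v <= U)%MS & (U <= v)%MS].
    exists (nz_row U); rewrite nz_row_eq0 U0 nz_row_sub; split=> //.
    rewrite -(geq_leqif (mxrank_leqif_sup (nz_row_sub U))) rU.
    by rewrite rank_rV nz_row_eq0 U0.
  have /choice[xi xiE] h : exists c, v *m rG h = c *: v.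
    apply/sub_rVP; apply: submx_trans Uv.
    by apply: submx_trans (submxMr _ vU) _; apply: (mxmoduleP modU).
  have inj_v c d : c *: v = d *: v -> c = d.
    move/eqP; rewrite -subr_eq0 -scalerBl scaler_eq0 (negPf v0) orbF subr_eq0.
    by move/eqP.
  have dxi : dual_group gT K xi.
    split=> [|h k]; apply: inj_v; first by rewrite -xiE repr_mx1 mulmx1 scale1r.
    by rewrite -xiE repr_mxM // mulmxA xiE -scalemxAl xiE scalerA.
  have xg : xi g = 1.
    by apply/eqP/negPn/negP => ?; apply: nosep; exists xi.
  apply: submx_trans Uv _; apply/sub_kermxP.
  by rewrite mulmxBr xiE xg scale1r mulmx1 subrr.
have rg1 : rG g = 1%:M.
  have := mx_reducible_semisimple (mxmodule1 rG) redG =>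
    /(_ `[< rG g = 1%:M >]).
  move=> semi; apply/asboolP/semi => -[I U W simU sumU _]; apply/asboolP.
  have : (1%:M <= kermx (rG g - 1%:M))%MS.
    by rewrite -sumU; apply/sumsmx_subP => i _; apply: simple_fixed.
  by move/sub_kermxP; rewrite mul1mx => /subr0_eq.
have : g \in rker rG by rewrite inE inG rg1 mulmx1 eqxx.
move/(fintype.subsetP (regular_mx_faithful _ _)); rewrite inE => /eqP e1.
by rewrite e1 eqxx in g1.
Qed.

(** * Twisted symmetric algebras become crossed products *)

Section ScalarExtensionOfTwistedAlgebra.
Variables (O : idomainType) (A : unitAlgType O) (K : fieldType).
Variables (f : {rmorphism O -> K}) (KA : falgType K).
Variable iota : {lrmorphism A -> KA | f \; *:%R}.
Hypothesis hKA : is_scalar_extension iota.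
Variables (t : {scalar A}) (tK : {scalar KA}).
Hypothesis htK : forall x, tK (iota x) = f (t x).

Lemma iotaZ c x : iota (c *: x) = f c *: iota x.
Proof. by rewrite linearZ. Qed.

(** The projection onto S and the identity agree on the image of A, hence
    everywhere by the uniqueness in the universal property. *)
Lemma span_iota (S : {vspace KA}) : (forall x, iota x \in S) -> S = fullv.
Proof.
move=> iS; apply/eqP; rewrite eqEsubv subvf; apply/subvP=> x _.
have [h [_ hU]] := hKA (GRing.Linear.clone O A KA _ iota _).
have projE : projv S =1 h by apply: hU => y; rewrite /= projv_id.
have idE : (idfun : {linear KA -> KA}) =1 h by apply: hU.
by rewrite -[x]/(idfun x) idE -projE memv_proj.
Qed.

Lemma eq_iota (V : vectType K) (g h : {linear KA -> V}) :
  (forall x, g (iota x) = h (iota x)) -> g =1 h.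
Proof.
move=> gh x.
have : x \in lker (linfun g - linfun h).
  rewrite (@span_iota (lker _)) ?memvf // => y.
  by rewrite memv_ker add_lfunE opp_lfunE !lfunE /= gh subrr.
by rewrite memv_ker add_lfunE opp_lfunE !lfunE subr_eq0 => /eqP.
Qed.

Lemma eq_iota_scalar (g h : KA -> K) : scalar g -> scalar h ->
  (forall x, g (iota x) = h (iota x)) -> g =1 h.
Proof.
move=> gl hl.
exact: (@eq_iota K^o (@mk_linear K KA K^o g gl) (@mk_linear K KA K^o h hl)).
Qed.

(** The coordinate functions of a basis are represented through the form. *)
Lemma dual_basis (S : {pred A}) : GRing.linear_closed S -> free_finite S ->
  symmetrizing_form S t ->
  exists n (b b' : 'I_n -> A), (forall i, b' i \in S) /\
    {in S, forall x, x = \sum_i t (b' i * x) *: b i}.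
Proof.
move=> linS [n [b [bS freeS]]] [_ symS].
have /choice[c cE] x : exists c : {ffun 'I_n -> O}, x \in S ->
    x = \sum_i c i *: b i /\
    forall d : {ffun 'I_n -> O}, x = \sum_i d i *: b i -> c = d.
  case: (boolP (x \in S)) => [/freeS[c [cE cU]]|_]; last by exists [ffun=> 0].
  by exists c.
have c_lin k x y : x \in S -> y \in S ->
    c (k *: x + y) = [ffun i => k * c x i + c y i].
  move=> xS yS; have [_] := cE _ (linS k _ _ xS yS); apply.
  have [xE _] := cE _ xS; have [yE _] := cE _ yS.
  rewrite {1}xE {1}yE scaler_sumr -big_split; apply: eq_bigr => i _ /=.
  by rewrite ffunE scalerDl scalerA.
have /choice[b' b'E] i : exists b', b' \in S /\
    {in S, forall x, t (b' * x) = c x i}.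
  have [k x y xS yS|b' [b'P _]] := symS (fun x => c x i).
    by rewrite c_lin // ffunE.
  by exists b'.
exists n, b, b'; split=> [i|x xS]; first by have [] := b'E i.
have [xE _] := cE _ xS; rewrite {1}xE; apply: eq_bigr => i _.
by have [_ ->] := b'E i.
Qed.

Variables (gT : finGroupType) (Abar : {pred A}) (Ag : gT -> {pred A}).
Variable a : gT -> A.
Hypothesis hAfree : free_finite (predT : {pred A}).
Hypothesis ht : symmetrizing_form (predT : {pred A}) t.
Hypothesis hA : twisted_symmetric t Abar Ag.
Hypothesis ha : twisted_units Abar Ag a.
Variable KAbar : {aspace KA}.
Hypothesis hKAbar : forall x, x \in KAbar <-> in_scalar_span iota Abar x.

Lemma iota_mem b : b \in Abar -> iota b \in KAbar.
Proof.
move=> bA; apply/hKAbar; exists 1%N, (fun=> 1), (fun=> b).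
by rewrite big_ord1 scale1r.
Qed.

(** An induction principle: a property closed under linear combinations holds
    on KAbar once it holds on Abar. *)
Lemma KAbar_ext (V : lmodType K) (g : {linear KA -> V}) (P : V -> Prop) :
  P 0 -> (forall k u v, P u -> P v -> P (k *: u + v)) ->
  (forall b, b \in Abar -> P (g (iota b))) -> forall x, x \in KAbar -> P (g x).
Proof.
move=> P0 Plin Pb x /hKAbar[n [c [b [bA ->]]]]; rewrite linear_sum.
elim/big_ind: _ => // [u v Pu Pv|i _]; last first.
  by rewrite linearZ /= -[_ *: _]addr0; apply: Plin => //; apply: Pb.
by rewrite -[u]scale1r; apply: Plin.
Qed.

Lemma Ag_right g x : x \in Ag g <-> exists2 b, b \in Abar & x = b * a g.
Proof. by have [_ /(_ g)[]] := ha. Qed.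

Lemma Ag_left g x : x \in Ag g <-> exists2 b, b \in Abar & x = a g * b.
Proof. by have [_ /(_ g)[]] := ha. Qed.

(** Identities between linear functions are checked on the image of A. For
    non-degeneracy, the dual basis expansion x = sum of t(b'_i x) b_i extends
    by linearity from A to KA, and from Abar to KAbar. *)
Lemma extension_crossed_product : crossed_product KAbar (iota \o a) tK.
Proof.
have [a1 aP] := ha.
have aU g : a g \is a GRing.unit by have [] := aP g.
have [[[A1 Alin AM] freeB symB _] _ dirA mulA AgE formA] := hA.
have iaU g : iota (a g) \is a GRing.unit by apply: rmorph_unit.
have traceC x y : tK (x * y) = tK (y * x).
  move: x; apply: eq_iota_scalar => [k u v|k u v|b].
  - by rewrite mulrDl -scalerAl linearP.
  - by rewrite mulrDr -scalerAr linearP.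
  move: y; apply: eq_iota_scalar => [k u v|k u v|c].
  - by rewrite mulrDr -scalerAr linearP.
  - by rewrite mulrDl -scalerAl linearP.
  by rewrite -!rmorphM !htK; have [-> //] := ht.
split=> //=.
- by rewrite -(rmorph1 iota) iota_mem.
- by rewrite a1 rmorph1.
- move=> g b; pose h := (amulr (iota (a g))^-1%R \o amull (iota (a g)))%VF.
  have hE x : h x = iota (a g) * x * (iota (a g))^-1 by rewrite comp_lfunE
    !lfunE.
  rewrite -hE; move: b; apply: (@KAbar_ext _ (mk_linear (linearP h))
    (fun v => v \in KAbar)) => [|k u v|b bA].
  + by rewrite mem0v.
  + by move=> uK vK; rewrite memvD ?memvZ.
  have /Ag_right[c cA ce] : a g * b \in Ag g by apply/Ag_left; exists b.
  by rewrite -[X in X \in _]/(h (iota b)) hE -rmorphM ce rmorphM mulrK ?iaU //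
    iota_mem.
- move=> g h; have /Ag_right[c cA ce] : a g * a h \in Ag (g * h)%g.
    apply/mulA; exists 1%N, (fun=> a g), (fun=> a h).
    by split=> [_|]; [split; [have [] := aP g | have [] := aP h] | rewrite
      big_ord1].
  by rewrite -rmorphM ce rmorphM mulrK ?iaU // iota_mem.
- move=> x; pose S := (\sum_g amulr (iota (a g)) @: KAbar)%VS.
  have : x \in S.
    rewrite (@span_iota S) ?memvf // => y.
    have [c [[cA ->] _]] := dirA y; rewrite rmorph_sum; apply: memv_suml => g _.
    have /Ag_right[b bA ->] := cA g; rewrite /= rmorphM.
    apply: (subvP (sumv_sup g isT (subvv _))).
    by apply/memv_imgP; exists (iota b); rewrite ?iota_mem // lfunE.
  case/memv_sumP=> u uS ->.
  have /choice[c cE] g : exists c, c \in KAbar /\ u g = c * iota (a g).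
    by have /memv_imgP[c cK ->] := uS g isT; exists c; rewrite lfunE.
  exists c; split=> [g|]; first by have [] := cE g.
  by apply: eq_bigr => g _; have [] := cE g.
- have [//|n [b [b' [_ bE]]]] := dual_basis _ hAfree ht.
  move=> x x0.
  have h_lin : linear (fun y => \sum_i tK (iota (b' i) * y) *: iota (b i)).
    move=> k u v; rewrite scaler_sumr -big_split; apply: eq_bigr => i _ /=.
    by rewrite mulrDr -scalerAr linearP scalerDl scalerA.
  have -> : x = mk_linear h_lin x.
    apply: (@eq_iota KA idfun (mk_linear h_lin)) => y /=.
    rewrite [in LHS](bE y) // rmorph_sum; apply: eq_bigr => i _.
    by rewrite /= iotaZ -htK rmorphM.
  by apply: big1 => i _; rewrite traceC x0 scale0r.
- have [//|n [b [b' [b'A bE]]]] := dual_basis _ freeB symB.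
  move=> x xK x0.
  have h_lin : linear (fun y => y - \sum_i tK (iota (b' i) * y) *: iota (b i)).
    move=> k u v; rewrite scalerBr addrACA -opprD; congr (_ - _).
    rewrite scaler_sumr -big_split; apply: eq_bigr => i _ /=.
    by rewrite mulrDr -scalerAr linearP scalerDl scalerA.
  have <- : mk_linear h_lin x = x.
    rewrite -[LHS]/(x - _) big1 ?subr0 // => i _.
    by rewrite traceC x0 ?scale0r // iota_mem.
  move: x xK {x0}; apply: (@KAbar_ext _ (mk_linear h_lin) (fun v => v = 0)).
  + by [].
  + by move=> k u v -> ->; rewrite scaler0 addr0.
  move=> y yA; rewrite -[LHS]/(_ - _); apply/eqP; rewrite subr_eq0; apply/eqP.
  rewrite [in LHS](bE y) // rmorph_sum; apply: eq_bigr => i _.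
  by rewrite /= iotaZ -htK rmorphM.
move=> g b g1; pose h x := tK (x * iota (a g)).
have h_lin : linear (h : KA -> K^o).
  by move=> k u v; rewrite /h mulrDl -scalerAl linearP.
move: b; apply: (@KAbar_ext K^o (@mk_linear K KA K^o h h_lin) (fun v => v = 0)).
- by [].
- by move=> k u v -> ->; rewrite scaler0 addr0.
move=> b bA; rewrite -[LHS]/(tK _) -rmorphM htK (formA g g1) ?rmorph0 //.
by apply/Ag_right; exists b.
Qed.

End ScalarExtensionOfTwistedAlgebra.

Theorem proposition2p3p15
  (O : idomainType) (hOnoeth : noetherian O) (hOint : integrally_closed O)
  (A : unitAlgType O) (hAfree : free_finite (predT : {pred A}))
  (t : {scalar A}) (ht : symmetrizing_form (predT : {pred A}) t)
  (gT : finGroupType) (Abar : {pred A}) (Ag : gT -> {pred A})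
  (hA : twisted_symmetric t Abar Ag)
  (a : gT -> A) (ha : twisted_units Abar Ag a)
  (K : splittingFieldType {fraction O}) (hK : galois 1%AS {:K})
  (KA : falgType K) (iota : {lrmorphism A -> KA | scal K \; *:%R})
  (hKA : is_scalar_extension iota)
  (KAbar : {aspace KA})
  (hKAbar : forall x, x \in KAbar <-> in_scalar_span iota Abar x)
  (tK : {scalar KA}) (htK : forall x, tK (iota x) = scal K (t x))
  (hKAss : split_semisimple KA)
  (hKAbarss : split_semisimple (subvs_of KAbar))
  (hKGss : group_algebra_split_semisimple gT K)
  (hG : cyclic [set: gT]) :
  exists f : set (subvs_of KAbar -> K) -> set (KA -> K),
    set_bij
      (orbits (conj_char (iota \o a)) setT (Irr (subvs_of KAbar)))
      (orbits (twist_char KAbar (iota \o a)) (dual_group gT K) (Irr KA))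
      f /\
    forall Obar,
      orbits (conj_char (iota \o a)) setT (Irr (subvs_of KAbar)) Obar ->
      let Om := f Obar in
      [/\ vsval (idem_sum Obar) = idem_sum Om,
          (ncard Obar * ncard Om)%N = #|[set: gT]|,
          forall chi, Om chi ->
            forall b, Res chi b = \sum_(psi \in Obar) psi b,
          forall psi, Obar psi ->
            forall x, Ind psi x = \sum_(chi \in Om) chi x &
          forall chi psi, Om chi -> Obar psi ->
            schur_element tK chi =
            (ncard Om)%:R * schur_element (Res tK) psi].
Proof.
have [ssE spE] := hKAss; have [ssB spB] := hKAbarss.
have cp := extension_crossed_product hKA htK hAfree ht hA ha hKAbar.
have sep := abelian_dual_separates (cyclic_abelian hG) hKGss.
exact: (crossed_product_clifford cp ssE spE ssB spB sep hG).
Qed.
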